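(* Let $Y$ be the bounded strong solution of the put-side obstacle problem and let $$\widetilde B(\tau)=\max\{x:\ln k_2\le x\le\ln K_2,\ Y(x,\tau)=K_2-e^x+k_2-K_1\},\qquad\tau\in(0,T],$$ be its inner free boundary, with $\widetilde B(0):=\lim_{\tau\searrow0}\widetilde B(\tau)$. Then $\widetilde B$ is nonincreasing and continuous on $(0,T]$, with $$\widetilde B(0)=\begin{cases}\ln K_2,&\text{if }q=0,\\[2pt] \max\left\{\ln k_2,\ \min\left\{\ln K_2,\ \ln\dfrac{r(K_2+k_2-K_1)}{q}\right\}\right\},&\text{if }q>0.\end{cases}$$ Furthermore, $\widetilde B$ is strictly decreasing on $\{\tau\in(0,T]:\widetilde B(\tau)>\ln k_2\}$, and if $q>0$ and $r(K_2+k_2-K_1)/q\le k_2$, then $\widetilde B(\tau)=\ln k_2$ for all $\tau\in(0,T]$.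
   Context: Constants: $0<K_1<k_1<k_2<K_2$, $\sigma>0$, $r>0$, $q\ge0$, $T>0$. Put $\mathcal Lu:=\frac{\sigma^2}{2}\partial_{xx}u+\left(r-q-\frac{\sigma^2}{2}\right)\partial_xu-ru$ and $\psi_2(x):=(K_2-e^x)^++k_2-K_1$. Let $Q=(\ln k_2,\infty)\times(0,T]$. For $1<p<\infty$, $\mathcal W_p(Q)$ is the set of $u\in C([\ln k_2,\infty)\times[0,T])$ such that, for all $R,\rho>0$, $u,\partial_xu,\partial_{xx}u,\partial_\tau u$ (weak derivatives) belong to $L^p$ of $\left(((\ln k_2,\infty)\cap(-R,R))\times(0,T)\right)\setminus B_\rho(\ln K_2,0)$, where $B_\rho$ denotes an open disc of radius $\rho$. A strong solution of the put-side obstacle problem is a function $Y\in\mathcal W_p(Q)$ with $Y\ge\psi_2$ in $Q$, $\partial_\tau Y-\mathcal LY\ge0$ almost everywhere in $Q$, $\partial_\tau Y-\mathcal LY=0$ almost everywhere on $\{Y>\psi_2\}$, $Y(x,0)=\psi_2(x)$ for $x>\ln k_2$, and $Y(\ln k_2,\tau)=K_2-K_1$ for $\tau\in[0,T]$. For every $1<p<\infty$ there is exactly one bounded strong solution, and it does not depend on $p$. The set defining $\widetilde B(\tau)$ contains $\ln k_2$ and is closed, so $\widetilde B(\tau)$ is well defined.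
   Formalization: The solution Y is required to be continuous on [ln k2,∞)×[0,T], including the final time τ=T, rather than only on [ln k2,∞)×[0,T); otherwise Y(·,T) could be altered freely and continuity of the boundary at T would fail. *)

(* Defs.v *)
From HB Require Import structures.
From mathcomp Require Import all_boot all_order all_algebra.
From mathcomp Require Import all_classical all_reals all_analysis.
From mathcomp Require Import ring.

Set Implicit Arguments.
Unset Strict Implicit.
Unset Printing Implicit Defensive.
Import Order.TTheory GRing.Theory Num.Theory.
Import numFieldNormedType.Exports.
Local Open Scope classical_set_scope.
Local Open Scope ring_scope.

(* Points of the plane are pairs (x, tau). *)

Section plane.
Context {R : realType}.
Implicit Types (f u v phi : R * R -> R) (D Omega : set (R * R)).

Definition leb2
    : {measure set (measurableTypeR R * measurableTypeR R) -> \bar R} :=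
  (@lebesgue_measure R \x @lebesgue_measure R)%E.

(* u belongs to L^p(D), through its extension by zero outside D. *)
Definition in_Lp (p : R) D u : Prop := u \_ D \in Lfun leb2 p%:E.

Fixpoint Ck (n : nat) f : Prop :=
  continuous f /\
  if n is m.+1 then
    forall e : R * R, (forall z, derivable f z e) /\ Ck m ('D_e f)
  else True.

Definition test_function Omega phi : Prop :=
  [/\ forall n, Ck n phi,
      compact (closure [set z | phi z != 0]) &
      closure [set z | phi z != 0] `<=` Omega].

(* Meaningful for u and v locally integrable in Omega; this is implied by the
   L^p conditions wherever the definition is used below. *)
Definition weak_derivative Omega (e : R * R) u v : Prop :=
  forall phi, test_function Omega phi ->
    \int[leb2]_(z in Omega) (u z * 'D_e phi z) =
    - \int[leb2]_(z in Omega) (v z * phi z).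

Definition dir_x : R * R := (1, 0).
Definition dir_tau : R * R := (0, 1).

(* The Euclidean disc: [ball] on a product type is a square. *)
Definition disc (a : R * R) (rho : R) : set (R * R) :=
  [set z | (z.1 - a.1) ^+ 2 + (z.2 - a.2) ^+ 2 < rho ^+ 2].

(* The maximum of A if it exists, 0 otherwise. *)
Definition set_max (A : set R) : R := xget 0 (A `&` ubound A).

End plane.

Section put_side_obstacle_problem.
Context {R : realType}.
Variables (K1 k2 K2 sigma r q T : R).
Implicit Types (p tau x : R) (Y u ux uxx utau : R * R -> R).

Definition domQ : set (R * R) := [set z | ln k2 < z.1 /\ 0 < z.2 <= T].
Definition openQ : set (R * R) := [set z | ln k2 < z.1 /\ 0 < z.2 < T].
Definition clQ : set (R * R) := [set z | ln k2 <= z.1 /\ 0 <= z.2 <= T].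

Definition truncQ (rad rho : R) : set (R * R) :=
  [set z | [/\ ln k2 < z.1, - rad < z.1 < rad & 0 < z.2 < T]]
    `\` disc (ln K2, 0) rho.

(* u is in the class W_p(Q), with weak derivatives ux, uxx and utau. *)
Definition Wp_with p u ux uxx utau : Prop :=
  [/\ {within clQ, continuous u},
      [/\ weak_derivative openQ dir_x u ux,
          weak_derivative openQ dir_x ux uxx &
          weak_derivative openQ dir_tau u utau] &
      forall rad rho, 0 < rad -> 0 < rho ->
        [/\ in_Lp p (truncQ rad rho) u,
            in_Lp p (truncQ rad rho) ux,
            in_Lp p (truncQ rad rho) uxx &
            in_Lp p (truncQ rad rho) utau]].

Definition psi2 x : R := Num.max (K2 - expR x) 0 + k2 - K1.

Definition opL u ux uxx : R * R -> R := fun z =>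
  sigma ^+ 2 / 2 * uxx z + (r - q - sigma ^+ 2 / 2) * ux z - r * u z.

Definition strong_solution p Y : Prop :=
  exists Yx Yxx Ytau : R * R -> R,
    Wp_with p Y Yx Yxx Ytau /\
    [/\ forall z, domQ z -> psi2 z.1 <= Y z,
        {ae leb2, forall z, domQ z -> 0 <= Ytau z - opL Y Yx Yxx z},
        {ae leb2, forall z, domQ z -> psi2 z.1 < Y z ->
           Ytau z - opL Y Yx Yxx z = 0},
        forall x, ln k2 < x -> Y (x, 0) = psi2 x &
        forall tau, 0 <= tau <= T -> Y (ln k2, tau) = K2 - K1].

Definition bounded_strong_solution p Y : Prop :=
  strong_solution p Y /\ exists M : R, forall z, clQ z -> `|Y z| <= M.

Definition contact_set Y tau : set R :=
  [set x | ln k2 <= x <= ln K2 /\ Y (x, tau) = K2 - expR x + k2 - K1].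

Definition inner_boundary Y tau : R := set_max (contact_set Y tau).

Lemma inner_boundary_max p Y tau : 0 < k2 -> k2 < K2 ->
  strong_solution p Y -> 0 <= tau <= T ->
  contact_set Y tau (inner_boundary Y tau) /\
  ubound (contact_set Y tau) (inner_boundary Y tau).
Proof.
move=> k0 kK [Yx [Yxx [Yt [[cY _ _] [_ _ _ _ Yb]]]]] tauT.
have K0 : 0 < K2 by exact: lt_trans kK.
have lkK : ln k2 <= ln K2 by rewrite ler_ln ?posrE// ltW.
have c0 : contact_set Y tau (ln k2).
  split; first by rewrite lexx lkK.
  by rewrite Yb// lnK ?posrE// subrK.
have Ab : ubound (contact_set Y tau) (ln K2) by move=> x [/andP[]].
have supA : has_sup (contact_set Y tau).
  by split; [exists (ln k2) | exists (ln K2)].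
set A := contact_set Y tau in c0 Ab supA *.
suff As : A (sup A).
  rewrite /inner_boundary /set_max -/A.
  case: xgetP => [? -> [] //|/(_ (sup A)) []].
  by split => //; apply: ub_le_sup => //; case: supA.
have s1 : ln k2 <= sup A by apply: ub_le_sup => //; case: supA.
have s2 : sup A <= ln K2 by apply: ge_sup => //; case: supA.
split; first by rewrite s1 s2.
pose g x := K2 - expR x + k2 - K1.
have cg : {for sup A, continuous g}.
  apply: cvgB; last exact: cvg_cst.
  apply: cvgD; last exact: cvg_cst.
  by apply: cvgB; [exact: cvg_cst | exact: continuous_expR].
apply/eqP; rewrite -subr_eq0 -normr_le0; apply/ler_addgt0Pr => e e0.
rewrite add0r.
have e2 : 0 < e / 2 by rewrite divr_gt0.
have /cvgrPdist_lt/(_ _ e2) :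
    Y @ within clQ (nbhs (sup A, tau)) --> Y (sup A, tau).
  by move/subspace_continuousP: cY; apply; split.
move=> /nbhs_ballP[d /= d0 dY].
move: cg => /cvgrPdist_lt/(_ _ e2)/nbhs_ballP[d' /= d'0 dg].
have dd : 0 < Num.min d d' by rewrite lt_min d0.
have [x Ax] := sup_adherent dd supA.
rewrite ltrBlDr -ltrBlDl lt_min => /andP[xd xd'].
have xs : x <= sup A by apply: ub_le_sup => //; case: supA.
have nx : `|sup A - x| = sup A - x by rewrite ger0_norm// subr_ge0.
have [/andP[x1 _] Yx'] := Ax.
have HY : `|Y (sup A, tau) - Y (x, tau)| < e / 2.
  apply: (dY (x, tau)); last by split; [exact: x1 | exact: tauT].
  by split; [rewrite /ball/= nx | exact: ballxx].
have Hg : `|g (sup A) - g x| < e / 2.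
  by apply: dg; rewrite /ball/= nx.
rewrite -/(g _) (_ : _ - _ = (Y (sup A, tau) - Y (x, tau)) - (g (sup A) - g x));
  last by rewrite Yx' -/(g x); ring.
rewrite (le_trans (ler_normB _ _))// [leRHS]splitr.
by apply: lerD; exact: ltW.
Qed.

End put_side_obstacle_problem.

(* Main.v *)
From HB Require Import structures.
From mathcomp Require Import all_boot all_order all_algebra.
From mathcomp Require Import all_classical all_reals all_analysis.
From mathcomp Require Import measurable_realfun.
From mathcomp Require Import ring lra.
Require Import Defs.

Set Implicit Arguments.
Unset Strict Implicit.
Unset Printing Implicit Defensive.
Import Order.TTheory GRing.Theory Num.Theory.
Import numFieldNormedType.Exports.
Local Open Scope classical_set_scope.
Local Open Scope ring_scope.

(* Only the distributional content of the obstacle problem is used.  Write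
   L for [opL] and G(x) = K2 - e^x + k2 - K1.  Then Y_tau - LY >= 0 in the
   interior of Q, with equality on the open set {Y > psi2}.  As L has constant
   coefficients, mollifying Y preserves these facts, so Y is locally a uniform
   limit of classical supersolutions, and -Y is one where Y > psi2; this is all
   that is needed to compare Y with smooth barriers.

   Comparing Y(x, tau + h) with Y(x, tau) shows that Y is nondecreasing in tau,
   so that the contact sets shrink.  Touching Y from below by G shows that
   q e^x <= r (K2 + k2 - K1) at a contact point x > ln k2, that is, that G is a
   supersolution to the left of x; comparison with G then makes each contact
   set an interval [ln k2, B(tau)], and the barrier G + c (x - x0)^2 makes
   contact persist for a short time in the interior of that interval.  These
   facts give the right continuity of B and, applied at tau = 0, its initial
   value; left continuity is the closedness of the contact set.

   If B were equal to b > ln k2 on [s, t], then V = Y(., . + h) - Y would be a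
   nonnegative supersolution to the right of b.  It is positive at x = ln K2,
   because Y(ln K2, tau) > Y(ln K2, 0) for tau > 0, so by a Hopf barrier it
   grows at least linearly at b.  Hence Y - G has a convex kink at a contact
   point, which is impossible for a supersolution. *)

(** * Smooth compactly supported kernels *)

(** The difficulty is that [-Y] is a supersolution only where [Y > psi2]. When [Y] is bounded from
    above, the barrier is placed so that a violation itself forces [Y > psi2]: either Y exceeds a
    function lying above G, or Y(x, tau) > Y(x, tau + h) >= psi2(x). In the Hopf argument the
    comparison region is instead known to avoid the contact set.

    Touching requires a strict inequality. It often comes from the zero-order term: as r > 0,
    shifting a barrier by a constant e leaves a margin r e.

    Kinks do the work of smooth fit. Below a convex kink there is room for M (x - x0)^2 with M as
    large as desired, and sigma^2 M then outweighs all other terms. The same argument at ln K2,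
    where the slope of psi2 jumps by K2, lifts Y off its initial value at once. This positivity is
    carried along x = ln K2 by a barrier on a thin tube, and from there to b by the Hopf barrier.

    Supersolutions are available for 0 < tau < T only, where small boxes avoid the corner (ln K2,
    0). Claims at T are reduced to earlier times by monotonicity or continuity. *)

Section flat_functions.
Context {R : realType}.
Implicit Types (P : {poly R}) (x y : R).

(** Induction on the polynomial, spending half of the rate at each step: the extra factor y is at
    most (2 / a) e^(a y / 2). *)
Lemma poly_le_expR P (a : R) : 0 < a ->
  exists2 C : R, 0 <= C & forall y, 0 <= y -> `|P.[y]| <= C * expR (a * y).
Proof.
elim/poly_ind: P a => [a a0|P c IH a a0].
  by exists 0 => // y _; rewrite horner0 normr0 mul0r.
have a20 : 0 < a / 2 by rewrite divr_gt0.
have [C C0 HC] := IH _ a20.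
exists (C * (2 / a) + `|c|) => [|y y0].
  by rewrite addr_ge0// mulr_ge0// divr_ge0// ltW.
have -> : (P * 'X + c%:P).[y] = P.[y] * y + c by rewrite !hornerE.
rewrite (le_trans (ler_normD _ _))// mulrDl lerD//; last first.
  by rewrite ler_peMr// -expR0 ler_expR mulr_ge0// ltW.
rewrite normrM (ger0_norm y0).
have -> : C * (2 / a) * expR (a * y) =
    (C * expR (a / 2 * y)) * ((2 / a) * expR (a / 2 * y)).
  by rewrite mulrACA -expRD -mulrDl -splitr.
rewrite ler_pM// ?HC// -ler_pdivrMl ?divr_gt0// invf_div.
by rewrite (le_trans _ (expR_ge1Dx _))// lerDr.
Qed.

(* For P = 1 this is the usual e^(-1/x); with a polynomial factor in 1/x the
   family is closed under differentiation, which gives infinite smoothness. *)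
Definition flat P x : R := if 0 < x then P.[x^-1] * expR (- x^-1) else 0.

(** With y = 1/x one has d/dx = - y^2 d/dy, so P(y) e^(-y) has derivative y^2 (P - P')(y) e^(-y). *)
Definition dflat P : {poly R} := 'X^2 * (P - P^`()).

(** The exponential beats x^(-2) P(1/x). A quadratic bound makes the difference quotient at 0 of
    order h, which gives the derivative 0 there. *)
Lemma flat_le_sqr P : exists C : R, forall x, `|flat P x| <= C * x ^+ 2.
Proof.
have [C C0 HC] := @poly_le_expR ('X^2 * P) 1 ltr01.
exists C => x; rewrite /flat; case: ifPn => x0; last first.
  by rewrite normr0 mulr_ge0// sqr_ge0.
have xV0 : 0 <= x^-1 by rewrite invr_ge0 ltW.
have H : x^-1 ^+ 2 * `|P.[x^-1]| <= C * expR x^-1.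
  have := HC _ xV0; rewrite mul1r hornerM hornerXn normrM.
  by rewrite (ger0_norm (sqr_ge0 _)).
rewrite normrM (ger0_norm (expR_ge0 _)) expRN.
have E0 : expR x^-1 != 0 by rewrite gt_eqF// expR_gt0.
rewrite -[leRHS](mulfK E0) ler_wpM2r ?invr_ge0 ?expR_ge0//.
by rewrite -(mulrA C) (mulrC (x ^+ 2)) mulrA -ler_pdivrMr ?exprn_gt0// mulrC -exprVn.
Qed.

Lemma is_derive_flat P x : is_derive x 1 (flat P) (flat (dflat P) x).
Proof.
have [x0|x0|->] := ltgtP x 0.
- apply: (@near_eq_is_derive _ _ _ (cst 0)) => //.
    near=> y; rewrite /flat ltNge ifN// negbK ltW//.
    by near: y; exact: lt_nbhsl.
  by rewrite /flat ltNge (ltW x0)/=; exact: is_derive_cst.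
- have xn0 : x != 0 by rewrite gt_eqF.
  have dV : is_derive x 1 (fun y : R => y^-1) (- x ^- 2).
    by have := @is_deriveV R id x 1 1 xn0 (is_derive_id _ _); rewrite scaler1.
  have dP := is_derive1_comp (is_derive_poly P x^-1) dV.
  have dN := @is_deriveN _ _ _ _ x 1 _ dV.
  have dE : is_derive x 1 (expR \o (fun y : R => - y^-1))
      (expR (- x^-1) * - - x ^- 2).
    by apply: is_derive1_comp; exact: is_derive_expR.
  apply: (@near_eq_is_derive _ _ _
      ((horner P \o (fun y : R => y^-1)) *
       (expR \o (fun y : R => - y^-1)))) => //.
    by near=> y; rewrite /flat ifT//; near: y; exact: lt_nbhsr.
  apply: (is_derive_eq (is_deriveM dP dE)).
  rewrite /flat x0 /dflat/= !hornerE /GRing.scale/= opprK.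
  by rewrite exprVn; ring.
- have [C HC] := flat_le_sqr P.
  have C0 : 0 <= C by have := HC 1; rewrite expr1n mulr1; exact: le_trans.
  have f0 : flat P 0 = 0 by rewrite /flat ltxx.
  have HL : h^-1 *: (flat P (h *: 1 + 0) - flat P 0) @[h --> 0^'] --> (0 : R).
    apply/cvgrPdist_le => e e0; near=> h.
    rewrite sub0r normrN f0 subr0 addr0 /GRing.scale/= mulr1 normrM normfV.
    have hn0 : h != 0 by near: h; exact: nbhs_dnbhs_neq.
    rewrite mulrC ler_pdivrMr ?normr_gt0// (le_trans (HC h))//.
    rewrite -(real_normK (num_real h)) expr2 mulrA ler_wpM2r//.
    rewrite (@le_trans _ _ ((C + 1) * `|h|))//.
      by rewrite ler_wpM2r// lerDl.
    rewrite mulrC -ler_pdivlMr ?ltr_wpDl//.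
    near: h; apply: dnbhs0_le; rewrite divr_gt0// ltr_wpDl//.
  rewrite /flat ltxx; apply: DeriveDef.
    by apply/cvg_ex; exists 0.
  by apply/cvg_lim.
Unshelve. all: by end_near. Qed.

Lemma continuous_flat P : continuous (flat P).
Proof.
move=> x; apply: differentiable_continuous; apply/derivable1_diffP.
by have [] := is_derive_flat P x.
Qed.

End flat_functions.

(** * A class of smooth functions closed under differentiation *)

Section smooth_functions.
Context {R : realType}.
Implicit Types (f g : R * R -> R) (z w e : R * R).

(** A syntactic class: structural induction yields differentiability, measurability, stability under
    reflection, and a derivative in every direction that is again in the class, hence [Ck] for all
    orders. *)
Inductive smooth : (R * R -> R) -> Prop :=
| smooth_cst (c : R) : smooth (cst c)
| smooth_fst : smooth fst
| smooth_snd : smooth snd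
| smoothD f g : smooth f -> smooth g -> smooth (f + g)
| smoothM f g : smooth f -> smooth g -> smooth (f * g)
| smooth_flat P f : smooth f -> smooth (flat P \o f).

Lemma smooth_differentiable f : smooth f -> forall z, differentiable f z.
Proof.
elim=> [c z|z|z|{}f g _ df _ dg z|{}f g _ df _ dg z|P {}f _ df z].
- exact: differentiable_cst.
- by apply: linear_differentiable => x; exact: cvg_fst.
- by apply: linear_differentiable => x; exact: cvg_snd.
- exact: differentiableD.
- exact: differentiableM.
- apply: differentiable_comp => //; apply/derivable1_diffP.
  by have [] := is_derive_flat P (f z).
Qed.

Lemma smooth_continuous f : smooth f -> continuous f.
Proof. by move=> /smooth_differentiable df z; exact: differentiable_continuous. Qed.

Lemma is_derive_comp_flat P f z e df : differentiable f z ->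
  is_derive z e f df -> is_derive z e (flat P \o f) (flat (dflat P) (f z) * df).
Proof.
move=> dif [dfe <-]; have [dP eP] := is_derive_flat P (f z).
have difP : differentiable (flat P) (f z) by exact/derivable1_diffP.
apply: DeriveDef; first by apply: diff_derivable; exact: differentiable_comp.
rewrite deriveE; last exact: differentiable_comp.
rewrite diff_comp//= deriv1E// derive1E eP deriveE//.
by rewrite /GRing.scale/= mulrC.
Qed.

Lemma smooth_is_derive f e : smooth f ->
  exists2 g, smooth g & forall z, is_derive z e f (g z).
Proof.
elim=> [c|||{}f g _ [f' sf' df] _ [g' sg' dg]|{}f g sf [f' sf' df] sg [g' sg' dg]|
        P {}f sf [f' sf' df]].
- by exists (cst 0) => [|z]; [exact: smooth_cst|exact: is_derive_cst].
- exists (cst e.1) => [|z]; first exact: smooth_cst.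
  have dz : differentiable (@fst R R) z by exact/smooth_differentiable/smooth_fst.
  apply: DeriveDef; first exact: diff_derivable.
  by rewrite deriveE// diff_lin// => x; exact: cvg_fst.
- exists (cst e.2) => [|z]; first exact: smooth_cst.
  have dz : differentiable (@snd R R) z by exact/smooth_differentiable/smooth_snd.
  apply: DeriveDef; first exact: diff_derivable.
  by rewrite deriveE// diff_lin// => x; exact: cvg_snd.
- exists (f' + g') => [|z]; first exact: smoothD.
  exact: is_deriveD.
- exists (f * g' + g * f') => [|z]; first by apply: smoothD; exact: smoothM.
  exact: is_deriveM.
- exists ((flat (dflat P) \o f) * f') => [|z].
    by apply: smoothM => //; exact: smooth_flat.
  by apply: is_derive_comp_flat => //; exact: smooth_differentiable.
Qed.

Lemma smooth_derive f e : smooth f -> smooth ('D_e f).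
Proof.
move=> /(smooth_is_derive e)[g sg dg]; rewrite (_ : 'D_e f = g)//.
by apply/funext => z; have [_] := dg z.
Qed.

Lemma smooth_derivable f e z : smooth f -> derivable f z e.
Proof. by move=> /(smooth_is_derive e)[g sg dg]; have [] := dg z. Qed.

Lemma smooth_Ck f n : smooth f -> Ck n f.
Proof.
elim: n f => [|n IH] f sf; split => //; try exact: smooth_continuous.
by move=> e; split => [z|]; [exact: smooth_derivable|exact/IH/smooth_derive].
Qed.

Lemma smooth_measurable f : smooth f ->
  measurable_fun [set: measurableTypeR R * measurableTypeR R] f.
Proof.
elim=> [c|||{}f g _ mf _ mg|{}f g _ mf _ mg|P {}f _ mf].
- exact: measurable_cst.
- exact: measurable_fst.
- exact: measurable_snd.
- exact: measurable_funD.
- exact: measurable_funM.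
- apply: measurableT_comp => //; apply: continuous_measurable_fun.
  exact: continuous_flat.
Qed.

Lemma smooth_reflect f z : smooth f -> smooth (fun w => f (z - w)).
Proof.
elim=> [c|||{}f g _ sf _ sg|{}f g _ sf _ sg|P {}f _ sf].
- exact: smooth_cst.
- rewrite (_ : (fun w => _) = cst z.1 + cst (-1) * fst).
    by apply: smoothD; [|apply: smoothM]; (exact: smooth_cst || exact: smooth_fst).
  by apply/funext => w /=; rewrite !fctE mulN1r.
- rewrite (_ : (fun w => _) = cst z.2 + cst (-1) * snd).
    by apply: smoothD; [|apply: smoothM]; (exact: smooth_cst || exact: smooth_snd).
  by apply/funext => w /=; rewrite !fctE mulN1r.
- exact: smoothD sf sg.
- exact: smoothM sf sg.
- exact: smooth_flat sf.
Qed.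

Lemma is_derive_line f z e (s : R) : differentiable f (z + s *: e) ->
  is_derive s 1 (fun s => f (z + s *: e)) ('D_e f (z + s *: e)).
Proof.
move=> df.
have dl : is_diff s (fun s : R => z + s *: e) ( *:%R^~ e).
  have -> : (fun s : R => z + s *: e) = cst z + ( *:%R^~ e) by [].
  rewrite -[X in is_diff _ _ X]add0r; exact: is_diffD.
have dl' : differentiable (fun s : R => z + s *: e) s by exact: ex_diff.
have dfl : differentiable (f \o (fun s : R => z + s *: e)) s.
  exact: differentiable_comp.
apply: DeriveDef; first exact: diff_derivable.
rewrite -[X in 'D_1 X s]/(f \o (fun s : R => z + s *: e)) (deriveE _ dfl).
rewrite (diff_comp dl' df)/=.
have -> : 'd (fun s : R => z + s *: e) s = *:%R^~ e :> (R -> _) by exact: diff_val.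
by rewrite scale1r deriveE.
Qed.

End smooth_functions.

(** * Closed squares and kernels supported in them *)

Section boxes.
Context {R : realType}.
Implicit Types (z w : R * R) (d : R).

(** Closed squares are products of intervals, so their compactness and area reduce to dimension
    one. *)
Definition cbox z d : set (R * R) :=
  [set w | `|w.1 - z.1| <= d /\ `|w.2 - z.2| <= d].

Lemma cboxE z d : cbox z d =
  `[z.1 - d, z.1 + d]%classic `*` `[z.2 - d, z.2 + d]%classic.
Proof.
by apply/seteqP; split=> [[x t]|[x t]]; rewrite /cbox/= !in_itv/= !ler_distl.
Qed.

Lemma compact_cbox z d : compact (cbox z d).
Proof. by rewrite cboxE; apply: compact_setX; exact: segment_compact. Qed.

Lemma closed_cbox z d : closed (cbox z d).
Proof. by apply: compact_closed; [exact: norm_hausdorff|exact: compact_cbox]. Qed.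

Lemma measurable_cbox z d :
  measurable (cbox z d : set (measurableTypeR R * measurableTypeR R)).
Proof. by rewrite cboxE; apply: measurableX; exact: measurable_itv. Qed.

Lemma leb2_cbox z d : 0 <= d ->
  leb2 (cbox z d : set (measurableTypeR R * measurableTypeR R)) = ((2 * d) ^+ 2)%:E.
Proof.
move=> d0; have L x : lebesgue_measure `[x - d, x + d]%classic = (2 * d)%:E.
  rewrite lebesgue_measure_itv/= lte_fin.
  move: d0; rewrite le_eqVlt => /predU1P[<-|d0].
    by rewrite subr0 addr0 ltxx mulr0.
  have -> : x - d < x + d by rewrite ltrD2l; lra.
  by rewrite -EFinB; congr EFin; ring.
rewrite cboxE [LHS]product_measure1E; [|exact: measurable_itv..].
transitivity ((2 * d)%:E * (2 * d)%:E)%E; last by rewrite -EFinM expr2.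
by congr (_ * _)%E; exact: L.
Qed.

Lemma cbox_nbhs z d : 0 < d -> nbhs z (cbox z d).
Proof.
move=> d0; apply/nbhs_ballP; exists d => //= w [w1 w2].
by split; rewrite distrC ltW.
Qed.

Lemma nbhs_cbox z (A : set (R * R)) : nbhs z A ->
  exists2 d, 0 < d & cbox z d `<=` A.
Proof.
move=> /nbhs_ballP[d/= d0 dA]; exists (d / 2); first by rewrite divr_gt0.
move=> w [w1 w2]; apply: dA; split; rewrite /ball/= distrC.
- by rewrite (le_lt_trans w1)// ltr_pdivrMr//; lra.
- by rewrite (le_lt_trans w2)// ltr_pdivrMr//; lra.
Qed.

Lemma cbox_subset z d d' : d <= d' -> cbox z d `<=` cbox z d'.
Proof. by move=> dd w [w1 w2]; split; exact: le_trans dd. Qed.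

Lemma cbox_cbox z z' d d' : cbox z d z' -> cbox z' d' `<=` cbox z (d + d').
Proof.
move=> [z1 z2] w [w1 w2]; split; rewrite [d + d']addrC.
- by rewrite (_ : _ - _ = (w.1 - z'.1) + (z'.1 - z.1)); [rewrite (le_trans (ler_normD _ _))// lerD|ring].
- by rewrite (_ : _ - _ = (w.2 - z'.2) + (z'.2 - z.2)); [rewrite (le_trans (ler_normD _ _))// lerD|ring].
Qed.

End boxes.

Section kernels.
Context {R : realType}.
Implicit Types (k f : R * R -> R) (z w e : R * R) (d : R).

Definition kernel d k := smooth k /\ forall w, ~ cbox 0 d w -> k w = 0.

Lemma kernel_derive d k e : kernel d k -> kernel d ('D_e k).
Proof.
move=> [sk k0]; split; first exact: smooth_derive.
move=> w wd; rewrite -[RHS](@derive_cst _ _ _ (0 : R) w e).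
apply: near_eq_derive.
apply: filterS (fun y (h : ~ cbox 0 d y) => k0 y h) _.
by apply: open_nbhs_nbhs; split => //; exact/closed_openC/closed_cbox.
Qed.

Lemma kernel_bounded d k : kernel d k ->
  exists2 C : R, 0 <= C & forall w, `|k w| <= C.
Proof.
move=> [sk k0].
have [E0|/set0P E0] := eqVneq (cbox (0 : R * R) d) set0.
  by exists 0 => // w; rewrite k0 ?normr0// E0.
have cn : {within cbox (0 : R * R) d, continuous (fun w => `|k w|)}.
  apply: continuous_subspaceT => w; apply: cvg_norm; exact: smooth_continuous.
have [z _ zmax] := compact_EVT_max E0 (@compact_cbox _ _ _) cn.
exists `|k z| => // w.
have [wd|wd] := pselect (cbox 0 d w); last by rewrite k0 ?normr0.
by apply: zmax; rewrite inE.
Qed.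

Lemma kernel_reflect_eq0 d k z w : kernel d k -> ~ cbox z d w -> k (z - w) = 0.
Proof.
move=> [_ k0] zw; apply: k0 => -[]/=; rewrite !subr0 => w1 w2.
by apply: zw; split; rewrite distrC.
Qed.

(** Reflected kernels are the test functions with which weak derivatives become derivatives of
    convolutions. *)
Lemma kernel_test_function d k z (Omega : set (R * R)) : kernel d k ->
  cbox z d `<=` Omega -> test_function Omega (fun w => k (z - w)).
Proof.
move=> kk zO.
have sub : closure [set w | k (z - w) != 0] `<=` cbox z d.
  rewrite closureE => w; apply; split; first exact: closed_cbox.
  move=> {}w/=; apply: contraNP => zw; apply/eqP; exact: kernel_reflect_eq0 zw.
split.
- by move=> n; apply: smooth_Ck; apply: smooth_reflect; case: kk.
- by apply: subclosed_compact sub; [exact: closed_closure|exact: compact_cbox].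
- exact: subset_trans zO.
Qed.

(** This minus sign cancels the one in [weak_derivative]. *)
Lemma derive_reflect k z w e : smooth k ->
  'D_e (fun w => k (z - w)) w = - 'D_e k (z - w).
Proof.
move=> sk.
have dk y : differentiable k y by exact: smooth_differentiable.
have dl : differentiable (fun w => z - w) w by [].
have dkl : differentiable (k \o (fun w => z - w)) w by exact: differentiable_comp.
rewrite [LHS](deriveE _ dkl) diff_comp//= deriveE//.
have -> : 'd (fun w => z - w) w = -%R :> (R * R -> R * R).
  by rewrite [LHS]diff_val//; apply/funext => y; rewrite /= sub0r.
by rewrite raddfN.
Qed.


End kernels.

(** * Mollification *)

Section bump.
Context {R : realType}.
Implicit Types (d x : R) (z w : R * R).

Let b d x : R := flat 1 (d ^+ 2 - x ^+ 2).

Let continuous_b d : continuous (b d).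
Proof.
move=> x.
apply: (@continuous_comp _ _ _ (fun x => d ^+ 2 - x ^+ 2) (flat 1)).
  by apply: cvgB; [exact: cvg_cst|exact: exprn_continuous].
exact: continuous_flat.
Qed.

Let b_ge0 d x : 0 <= b d x.
Proof. by rewrite /b /flat; case: ifP => // _; rewrite hornerE mul1r expR_ge0. Qed.

Definition bump d w : R := b d w.1 * b d w.2.

Lemma bump_ge0 d w : 0 <= bump d w.
Proof. by rewrite mulr_ge0. Qed.

Lemma kernel_bump d : 0 < d -> kernel d (bump d).
Proof.
move=> d0; split.
  rewrite (_ : bump d = (flat 1 \o (cst (d ^+ 2) + cst (-1) * (fst * fst))) *
                        (flat 1 \o (cst (d ^+ 2) + cst (-1) * (snd * snd)))).
    apply: smoothM; apply: smooth_flat; apply: smoothD; try exact: smooth_cst;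
      apply: smoothM; try exact: smooth_cst; apply: smoothM;
      (exact: smooth_fst || exact: smooth_snd).
  by apply/funext => w; rewrite /bump /b !fctE/= !mulN1r.
move=> w wd; apply/eqP; rewrite /bump mulf_eq0; apply/orP.
have b0 x : d < `|x| -> b d x = 0.
  move=> dx; rewrite /b /flat ifF//; apply/negbTE; rewrite -leNgt subr_le0.
  by rewrite -(real_normK (num_real x)) ler_sqr ?nnegrE ?ltW// (lt_trans d0).
have [w1|w1] := leP `|w.1| d; last by left; rewrite b0.
have [w2|w2] := leP `|w.2| d; last by right; rewrite b0.
by exfalso; apply: wd; rewrite /cbox/= !subr0.
Qed.

Let bump_integral d z : 0 < d ->
  (\int[leb2]_w (bump d (z - w))%:E =
   (\int[lebesgue_measure]_x (b d x)%:E) * (\int[lebesgue_measure]_x (b d x)%:E))%E.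
Proof.
move=> d0; have shift x : (\int[lebesgue_measure]_y (b d (x - y))%:E =
    \int[lebesgue_measure]_y (b d y)%:E)%E.
  have dF (y : R) : is_derive y 1 (fun y => y - x) 1.
    by apply: is_derive_eq; rewrite subr0.
  have F' : derive1 (fun y : R => y - x) = cst 1.
    by apply/funext => y; rewrite derive1E; have [_] := dF y.
  rewrite [RHS](@increasing_ge0_integration_by_substitutionT _ (fun y => y - x) (b d)).
  - apply: eq_integral => y _; rewrite F' /b/= !fctE/= mulr1.
    by rewrite -[(x - y) ^+ 2]sqrrN opprB.
  - by move=> ? ?; rewrite ltrD2r.
  - by rewrite F'; exact: cst_continuous.
  - by rewrite F'; exact: is_cvg_cst.
  - by rewrite F'; exact: is_cvg_cst.
  - by move=> y; have [] := dF y.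
  - exact: cvg_addrr_Ny.
  - exact: cvg_addrr.
  - exact: continuous_b.
  - exact: b_ge0.
have cb (x : R) : continuous (fun y => b d (x - y)).
  move=> y; apply: (@continuous_comp _ _ _ (fun y => x - y) (b d)).
    by apply: cvgB; [exact: cvg_cst|exact: cvg_id].
  exact: continuous_b.
have mb x : measurable_fun [set: measurableTypeR R] (fun y => (b d (x - y))%:E).
  by apply/measurable_EFinP; exact: continuous_measurable_fun.
rewrite [LHS]fubini_tonelli1/=; last 2 first.
- apply/measurable_EFinP; apply: smooth_measurable; apply: smooth_reflect.
  by case: (kernel_bump d0).
- by move=> w; rewrite lee_fin bump_ge0.
rewrite /fubini_F.
set I := (\int[lebesgue_measure]_x (b d x)%:E)%E in shift *.
have I0 : (0 <= I)%E by apply: integral_ge0 => x _; rewrite lee_fin.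
have inner x : (\int[lebesgue_measure]_y (bump d (z - (x, y)))%:E =
    (b d (z.1 - x))%:E * I)%E.
  rewrite -(shift z.2) -ge0_integralZl.
  - by apply: eq_integral => y _; rewrite -EFinM.
  - exact: measurableT.
  - exact: mb.
  - by move=> y _; rewrite lee_fin.
  - by rewrite lee_fin.
under eq_integral => x _ do rewrite inner.
rewrite -[X in (X * _)%E](shift z.1); apply: ge0_integralZr.
- exact: measurableT.
- exact: mb.
- by move=> x _; rewrite lee_fin.
- exact: I0.
Qed.

(** The kernel is left unnormalised; a mass independent of the centre allows dividing by one
    constant later. *)
Lemma bump_mass d z : 0 < d ->
  \int[leb2]_w bump d (z - w) = \int[leb2]_w bump d (0 - w).
Proof. by move=> d0; rewrite /Rintegral !bump_integral. Qed.

End bump.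

(** * Convolution of integrable functions with kernels *)

Section convolution.
Context {R : realType}.
Implicit Types (k f g : R * R -> R) (z w e : R * R) (d : R).
Let mu : {measure set (measurableTypeR R * measurableTypeR R) -> \bar R} := leb2.

(** Applied to functions cut off by zero outside a box, which makes them integrable on the plane;
    nothing changes at points [z] whose kernel square lies in the box. *)
Definition conv f k z : R := \int[leb2]_w (f w * k (z - w)).

Lemma conv_integrable f k d z : kernel d k -> mu.-integrable setT (EFin \o f) ->
  mu.-integrable setT (EFin \o (fun w => f w * k (z - w))).
Proof.
move=> kk intf.
have [C C0 Ck] := kernel_bounded kk.
have := @integrableMl _ _ _ mu _ measurableT (EFin \o f) (fun w => k (z - w)) intf.
apply.
  by apply: smooth_measurable; apply: smooth_reflect; case: kk.
by exists C; split => [|M CM w _]; [exact: num_real|exact/(le_trans (Ck _))/ltW].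
Qed.

(** Differentiation under the integral, dominated by C |f| with C a bound for the derivative of the
    kernel. The parameter runs along the line z + s e, which serves both coordinates. *)
Lemma is_derive_conv f k d z e (s : R) : kernel d k ->
  mu.-integrable setT (EFin \o f) ->
  is_derive s 1 (fun s => conv f k (z + s *: e)) (conv f ('D_e k) (z + s *: e)).
Proof.
move=> kk intf.
have kek := kernel_derive e kk.
have [C C0 Ck] := kernel_bounded kek.
pose F := fun (h : R) w => f w * k (z + h *: e - w).
have dF (h : R) w : is_derive h 1 (F ^~ w) (f w * 'D_e k (z + h *: e - w)).
  have -> : F ^~ w = (f w) *: (fun h : R => k ((z - w) + h *: e)).
    by apply/funext => y /=; rewrite /F addrAC.
  have dk : differentiable k ((z - w) + h *: e).
    by apply: smooth_differentiable; case: kk.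
  rewrite addrAC -[_ * _]/(_ *: _).
  exact: is_deriveZ (is_derive_line dk).
have cvF := @cvg_differentiation_under_integral R _ _ mu F setT measurableT s
   (s - 1) (s + 1) _ _ _ (fun w => C * `|f w|) _ _ _.
have d1 (h : R) w : partial1of2 F h w = f w * 'D_e k (z + h *: e - w).
  by rewrite partial1of2E; have [] := dF h w.
have {}cvF : h^-1 *: (conv f k (z + (h + s) *: e) - conv f k (z + s *: e)) @[h --> 0^'] -->
    conv f ('D_e k) (z + s *: e).
  have -> : conv f ('D_e k) (z + s *: e) = \int[mu]_w partial1of2 F s w.
    by apply: eq_Rintegral => w _; rewrite d1.
  apply: cvF.
  - by rewrite /= in_itv/=; apply/andP; split; lra.
  - by move=> h _; exact: (conv_integrable _ kk).
  - by move=> h w _ _; have [] := dF h w.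
  - by move=> w; rewrite mulr_ge0.
  - exact: (@integrableZl _ _ _ mu setT measurableT C _ (integrable_norm intf)).
  - by move=> h w _ _; rewrite d1 normrM mulrC ler_wpM2r.
apply: DeriveDef.
  apply/cvg_ex; exists (conv f ('D_e k) (z + s *: e)).
  by under eq_fun do rewrite /= [_ *: 1]mulr1.
apply/cvg_lim; first exact: norm_hausdorff.
by under eq_fun do rewrite /= [_ *: 1]mulr1.
Qed.

Lemma le_conv f k d C z : kernel d k -> mu.-integrable setT (EFin \o f) ->
  (forall w, `|k w| <= C) -> `|conv f k z| <= C * \int[mu]_w `|f w|.
Proof.
move=> kk intf kC; have ik := conv_integrable z kk intf.
have iaf : mu.-integrable setT (EFin \o (fun w => `|f w|)) by exact: integrable_norm.
rewrite (le_trans (le_normr_Rintegral _ ik))// -RintegralZl//.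
apply: le_Rintegral => //; first exact: integrable_norm.
- exact: (@integrableZl _ _ _ mu setT measurableT C _ iaf).
- by move=> w _; rewrite normrM mulrC ler_wpM2r.
Qed.

Lemma convD f g k d z : kernel d k ->
  mu.-integrable setT (EFin \o f) -> mu.-integrable setT (EFin \o g) ->
  conv (f + g) k z = conv f k z + conv g k z.
Proof.
move=> kk intf intg; rewrite /conv -RintegralD//; try exact: (conv_integrable z kk).
by apply: eq_Rintegral => w _; rewrite fctE mulrDl.
Qed.

Lemma convZ (a : R) f k d z : kernel d k ->
  mu.-integrable setT (EFin \o f) -> conv (a *: f) k z = a * conv f k z.
Proof.
move=> kk intf; rewrite /conv -RintegralZl//; last exact: (conv_integrable z kk).
by apply: eq_Rintegral => w _; rewrite -mulrA.
Qed.

Lemma integrable_cst_restrict (B : set (R * R)) (c : R) :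
  measurable (B : set (measurableTypeR R * measurableTypeR R)) ->
  (mu B < +oo)%E -> mu.-integrable setT (EFin \o (cst c \_ B)).
Proof.
move=> mB Boo.
have : mu.-integrable B (EFin \o cst c).
  apply: measurable_bounded_integrable => //.
  by exists `|c|; split => // M cM w _; exact: ltW.
by move/(integrable_mkcond _ mB); rewrite restrict_EFin.
Qed.

Lemma bump_integrable d z : 0 < d ->
  mu.-integrable setT (EFin \o (fun w => bump d (z - w))).
Proof.
move=> d0; have kb := kernel_bump d0.
have muB : (mu (cbox z d) < +oo)%E by rewrite [X in (X < _)%E]leb2_cbox ?ltW// ltry.
have i1 := integrable_cst_restrict 1 (@measurable_cbox _ z d) muB.
have := conv_integrable z kb i1; apply: eq_integrable => // w _ /=.
congr EFin; rewrite /patch; case: ifPn => zw; first by rewrite mul1r.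
by rewrite mul0r (kernel_reflect_eq0 kb)// => /mem_set; apply/negP.
Qed.

Lemma bump_mass_gt0 d : 0 < d -> 0 < \int[leb2]_w bump d (0 - w) :> R.
Proof.
move=> d0; pose B := cbox (0 : R * R) (d / 2).
have d20 : 0 < d / 2 by rewrite divr_gt0.
(* A lower bound for the bump on the square of half size: there d^2 - x^2 >= 3 d^2 / 4 in each
   coordinate. *)
pose m : R := expR (- (d ^+ 2 * 3 / 4)^-1) ^+ 2.
have m0 : 0 < m by rewrite exprn_gt0// expR_gt0.
have kb := kernel_bump d0.
have muB : mu B = (d ^+ 2)%:E.
  by rewrite [LHS]leb2_cbox ?ltW//; congr EFin; field.
have lt : m * d ^+ 2 <= \int[mu]_w bump d (0 - w).
  have -> : m * d ^+ 2 = \int[mu]_w (cst m \_ B) w.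
    rewrite -Rintegral_mkcond Rintegral_cst//; last exact: measurable_cbox.
    by rewrite [X in fine X]muB.
  apply: le_Rintegral => //.
  - by apply: integrable_cst_restrict; [exact: measurable_cbox|rewrite muB ltry].
  - exact: bump_integrable.
  move=> w _; rewrite /patch; case: ifPn => [/set_mem[]/=|_]; last exact: bump_ge0.
  rewrite !subr0 => w1 w2.
  have key (x : R) : `|x| <= d / 2 ->
      expR (- (d ^+ 2 * 3 / 4)^-1) <= flat 1 (d ^+ 2 - (0 - x) ^+ 2).
    move=> xd; have x2 : x ^+ 2 <= d ^+ 2 / 4.
      rewrite -(real_normK (num_real x)).
      have -> : d ^+ 2 / 4 = (d / 2) ^+ 2 by field.
      by rewrite ler_sqr ?nnegrE// ltW.
    have dd : 0 < d ^+ 2 by rewrite exprn_gt0.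
    have D0 : d ^+ 2 * 3 / 4 <= d ^+ 2 - (0 - x) ^+ 2.
      by rewrite sub0r sqrrN; lra.
    have P0 : 0 < d ^+ 2 * 3 / 4 by lra.
    rewrite /flat ifT; last exact: lt_le_trans D0.
    rewrite hornerC mul1r ler_expR lerN2 lef_pV2 ?posrE//.
    exact: lt_le_trans D0.
  by rewrite /m expr2 ler_pM ?expR_ge0//; exact: key.
by apply: lt_le_trans lt; rewrite mulr_gt0// exprn_gt0.
Qed.

(** On a set of finite measure, |u| <= 1 + |u|^p gives integrability. *)
Lemma in_Lp_integrable (p : R) (D B : set (R * R)) (u : R * R -> R) :
  1 <= p -> in_Lp p D u ->
  measurable (B : set (measurableTypeR R * measurableTypeR R)) ->
  (mu B < +oo)%E -> B `<=` D -> mu.-integrable setT (EFin \o (u \_ B)).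
Proof.
move=> p1 uD mB Boo BD.
have iuD := Lfun_integrable p1 uD.
have muD : measurable_fun [set: measurableTypeR R * measurableTypeR R] (u \_ D).
  by move: uD; rewrite /in_Lp inE => /andP[/[!inE]].
have i1 := integrable_cst_restrict 1 mB Boo.
have m1 : measurable_fun [set: measurableTypeR R * measurableTypeR R]
    (\1_B : R * R -> R).
  exact: (@measurable_indic _ (measurableTypeR R * measurableTypeR R)%type R setT B mB).
have uE : u \_ B = (u \_ D) * (\1_B : R * R -> R).
  apply/funext => w; rewrite !fctE /patch indicE.
  case: ifPn => [wB|wB]; last by rewrite mulr0.
  by rewrite ifT ?mulr1//; apply/mem_set/BD/set_mem.
pose g w : R := (cst (1 : R) \_ B) w + `|(u \_ D) w| `^ p.
have ig : mu.-integrable setT (EFin \o g).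
  by have := integrableD measurableT i1 iuD.
apply: (@le_integrable _ _ _ mu setT measurableT (EFin \o (u \_ B)) (EFin \o g)).
- by apply/measurable_EFinP; rewrite uE; exact: measurable_funM.
- move=> w _; rewrite /= lee_fin [leRHS]ger0_norm /g /patch.
    case: ifPn => wB; last by rewrite normr0 add0r; exact: powR_ge0.
    rewrite ifT; last by apply/mem_set/BD/set_mem.
    have [u1|u1] := leP `|u w| 1; first by rewrite ler_wpDr//; exact: powR_ge0.
    by rewrite ler_wpDl//= -[leLHS]powRr1// ler_powR// ltW.
  by apply: addr_ge0; [case: ifP|exact: powR_ge0].
- exact: ig.
Qed.

End convolution.

Section classical_derivatives.
Context {R : realType}.
Implicit Types (u ux uxx ut : R * R -> R).

(** The derivatives are evaluated pointwise at a minimum, whose existence rests on the continuity of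
    [u]. *)
Definition C21 u ux uxx ut : Prop :=
  [/\ continuous u,
      forall x t : R, is_derive x 1 (fun y => u (y, t)) (ux (x, t)),
      forall x t : R, is_derive x 1 (fun y => ux (y, t)) (uxx (x, t)) &
      forall x t : R, is_derive t 1 (fun s => u (x, s)) (ut (x, t))].

Lemma bounded_derive_lipschitz (f df : R -> R) (C a b : R) :
  (forall x : R, is_derive x 1 f (df x)) -> (forall x, `|df x| <= C) ->
  `|f b - f a| <= C * `|b - a|.
Proof.
move=> dfE dfC.
have H (x y : R) : x <= y -> `|f y - f x| <= C * `|y - x|.
  move=> xy; have cf : {within `[x, y], continuous f}.
    apply: derivable_within_continuous => w _.
    by have [] := dfE w.
  have [c _ ->] := MVT_segment xy (fun w _ => dfE w) cf.
  by rewrite normrM ler_wpM2r.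
by have [/H//|/ltW/H] := leP a b; rewrite distrC (distrC a).
Qed.

(** Bounded partial derivatives make [u] Lipschitz along a path of two axis-parallel segments. This
    gives the joint continuity of convolutions. *)
Lemma bounded_partials_continuous (u ux ut : R * R -> R) (C : R) :
  (forall x t : R, is_derive x 1 (fun y => u (y, t)) (ux (x, t))) ->
  (forall x t : R, is_derive t 1 (fun s => u (x, s)) (ut (x, t))) ->
  (forall z, `|ux z| <= C) -> (forall z, `|ut z| <= C) -> continuous u.
Proof.
move=> dx dt Cx Ct [x t].
have C0 : 0 <= C by apply: le_trans (Cx (0, 0)).
have C10 : 0 < 2 * C + 1 by rewrite ltr_wpDl// mulr_ge0.
apply/cvgrPdist_le => e e0.
(* Two segments cost at most C times this length each; the summand 1 covers C = 0. *)
have d0 : 0 < e / (2 * C + 1) by rewrite divr_gt0.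
apply: filterS (cbox_nbhs (x, t) d0) => -[y s] [/= yx st].
rewrite distrC in yx; rewrite distrC in st.
have H1 := bounded_derive_lipschitz y x (fun w => dx w t) (fun w => Cx (w, t)).
have H2 := bounded_derive_lipschitz s t (fun w => dt y w) (fun w => Ct (y, w)).
have -> : u (x, t) - u (y, s) = (u (x, t) - u (y, t)) + (u (y, t) - u (y, s)) by ring.
rewrite (le_trans (ler_normD _ _))// (le_trans (lerD H1 H2))//.
rewrite -mulrDr (@le_trans _ _ (C * (2 * (e / (2 * C + 1)))))//.
  by rewrite ler_wpM2l// mulr_natl mulr2n; exact: lerD.
have -> : C * (2 * (e / (2 * C + 1))) = e * (2 * C) / (2 * C + 1) by ring.
by rewrite ler_pdivrMr// ler_wpM2l ?lerDl// ltW.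
Qed.

End classical_derivatives.

Section super_at.
Context {R : realType}.
Variables (sigma r q : R).
Implicit Types (u ux uxx ut U Ux Uxx Ut : R * R -> R) (z : R * R).

(* u is, near z, a uniform limit of classical supersolutions.  Subsolutions are
   handled through their opposites. *)
Definition super_at u z : Prop :=
  exists2 d : R, 0 < d & forall eta : R, 0 < eta ->
    exists U Ux Uxx Ut, [/\ C21 U Ux Uxx Ut,
      forall w, cbox z d w -> `|U w - u w| <= eta &
      forall w, cbox z d w -> 0 <= Ut w - opL sigma r q U Ux Uxx w].

End super_at.

Section mollification.
Context {R : realType}.
Implicit Types (k f g : R * R -> R) (z w e : R * R) (d x t : R).
Let mu : {measure set (measurableTypeR R * measurableTypeR R) -> \bar R} := leb2.

Lemma is_derive_conv_x f k d x t : kernel d k ->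
  mu.-integrable setT (EFin \o f) ->
  is_derive x 1 (fun y => conv f k (y, t)) (conv f ('D_dir_x k) (x, t)).
Proof.
move=> kk intf.
have E y : (y, t) = (0, t) + y *: dir_x :> R * R.
  by congr pair => /=; rewrite /GRing.scale/= ?mulr1 ?mulr0 ?add0r ?addr0.
rewrite E (_ : (fun y => _) = (fun y => conv f k ((0, t) + y *: dir_x))).
  exact: (is_derive_conv _ _ _ kk).
by apply/funext => y; rewrite -E.
Qed.

Lemma is_derive_conv_t f k d x t : kernel d k ->
  mu.-integrable setT (EFin \o f) ->
  is_derive t 1 (fun s => conv f k (x, s)) (conv f ('D_dir_tau k) (x, t)).
Proof.
move=> kk intf.
have E s : (x, s) = (x, 0) + s *: dir_tau :> R * R.
  by congr pair => /=; rewrite /GRing.scale/= ?mulr1 ?mulr0 ?add0r ?addr0.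
rewrite E (_ : (fun s => _) = (fun s => conv f k ((x, 0) + s *: dir_tau))).
  exact: (is_derive_conv _ _ _ kk).
by apply/funext => s; rewrite -E.
Qed.

Lemma conv_continuous f k d : kernel d k ->
  mu.-integrable setT (EFin \o f) -> continuous (conv f k).
Proof.
move=> kk intf.
have kx := kernel_derive dir_x kk; have kt := kernel_derive dir_tau kk.
have [C1 C10 HC1] := kernel_bounded kx.
have [C2 C20 HC2] := kernel_bounded kt.
pose I := \int[mu]_w `|f w|.
have I0 : 0 <= I by apply: Rintegral_ge0.
apply: (@bounded_partials_continuous _ _ (conv f ('D_dir_x k)) (conv f ('D_dir_tau k)) ((C1 + C2) * I)).
- by move=> x t; exact: is_derive_conv_x kk intf.
- by move=> x t; exact: is_derive_conv_t kk intf.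
- move=> z; apply: le_trans (le_conv z kx intf HC1) _.
  by rewrite ler_wpM2r// lerDl.
- move=> z; apply: le_trans (le_conv z kt intf HC2) _.
  by rewrite ler_wpM2r// lerDr.
Qed.

Lemma conv_ge0 f k d z : kernel d k -> (forall w, 0 <= k w) ->
  mu.-integrable setT (EFin \o f) -> {ae mu, forall w, 0 <= f w} ->
  0 <= conv f k z.
Proof.
move=> kk k0 intf f0.
have ik := conv_integrable z kk intf.
have ik' := conv_integrable z kk (integrable_norm intf).
(* Almost everywhere f = |f|, and with |f| the integrand is nonnegative at every point. *)
rewrite /conv [X in 0 <= X](_ : _ = \int[mu]_w (`|f w| * k (z - w))).
  by apply: Rintegral_ge0 => w _; rewrite mulr_ge0.
congr fine; apply: ae_eq_integral.
- exact: measurableT.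
- exact: (measurable_int mu ik).
- exact: (measurable_int mu ik').
- by apply: (@filterS _ (almost_everywhere mu) (ae_filter_ringOfSetsType mu) _ _ _ f0) => w fw _ /=; rewrite ger0_norm.
Qed.

(** The weak derivative is tested with w -> k (z - w). Its support lies in [B], so the integrals
    over [Omega] are convolutions of the functions cut off to [B]. *)
Lemma weak_derivative_conv (Omega B : set (R * R)) e u v k d z :
  weak_derivative Omega e u v -> kernel d k ->
  cbox z d `<=` B -> B `<=` Omega ->
  mu.-integrable setT (EFin \o (u \_ B)) ->
  mu.-integrable setT (EFin \o (v \_ B)) ->
  conv (u \_ B) ('D_e k) z = conv (v \_ B) k z.
Proof.
move=> uv kk zB BO iu iv.
have kek := kernel_derive e kk.
have cut h k' : kernel d k' ->
    \int[mu]_(w in Omega) (h w * k' (z - w)) = conv (h \_ B) k' z.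
  move=> kk'; rewrite Rintegral_mkcond; apply: eq_Rintegral => w _.
  rewrite /patch; case: ifPn => wO; case: ifPn => wB //.
  - rewrite mul0r (kernel_reflect_eq0 kk') ?mulr0// => /zB/mem_set.
    exact/negP.
  - by move/set_mem/BO/mem_set : wB; rewrite (negbTE wO).
  - by rewrite [RHS]mul0r.
have := uv _ (kernel_test_function kk (subset_trans zB BO)).
rewrite (cut v k kk) => H.
apply: oppr_inj; rewrite -H -mulN1r -(convZ _ _ kek iu).
have -> : (-1) *: (u \_ B) = (fun w => - u w) \_ B.
  apply/funext => w; transitivity (-1 * (u \_ B) w) => //.
  by rewrite mulN1r /patch; case: ifP => // _; exact: oppr0.
rewrite -(cut _ _ kek); apply: eq_Rintegral => w _.
by rewrite derive_reflect ?mulrN ?mulNr//; case: kk.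
Qed.

(** Uniform continuity in which the second point may leave [K], as kernel squares centred in [K]
    do. *)
Lemma compact_uniform_cbox (u : R * R -> R) (K : set (R * R)) (eta : R) :
  compact K -> (forall z, K z -> {for z, continuous u}) -> 0 < eta ->
  exists2 d, 0 < d & forall z w, K z -> cbox z d w -> `|u w - u z| <= eta.
Proof.
move=> cK cu eta0.
have eta20 : 0 < eta / 2 by rewrite divr_gt0.
have := cK; rewrite compact_near_coveringP => /(_ _ (0 : R)^'+
  (fun d z => forall w, cbox z d w -> `|u w - u z| <= eta) _).
have loc z : K z -> \forall x \near z & d \near (0 : R)^'+,
    forall w, cbox x d w -> `|u w - u x| <= eta.
  move=> Kz; have /cvgrPdist_le/(_ _ eta20)/nbhs_cbox[a a0 ha] := cu z Kz.
  have a20 : 0 < a / 2 by rewrite divr_gt0.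
  exists (cbox z (a / 2), [set i | i <= a / 2]).
    by split; [exact: cbox_nbhs|exact: nbhs_right_ltW].
  move=> [x d] [/= zx da] w xw.
  have ux : `|u z - u x| <= eta / 2 by apply/ha/cbox_subset/zx; lra.
  have uw : `|u z - u w| <= eta / 2.
    apply: ha; have := cbox_cbox zx (cbox_subset da xw); apply: cbox_subset.
    by rewrite -splitr.
  rewrite (_ : u w - u x = (u z - u x) - (u z - u w)); last by ring.
  by rewrite (le_trans (ler_normB _ _))// [leRHS]splitr lerD.
move=> /(_ loc) H.
have [d [/= d0 dH]] := filter_ex (filterI (nbhs_right_gt (0 : R)) H).
by exists d => // z w Kz; exact: dH.
Qed.

(** For an unnormalised kernel the constant is compared with the convolution after multiplication by
    the mass. *)
Lemma conv_close f k d z (c eta : R) : kernel d k -> (forall w, 0 <= k w) ->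
  mu.-integrable setT (EFin \o f) ->
  mu.-integrable setT (EFin \o (fun w => k (z - w))) ->
  (forall w, cbox z d w -> `|f w - c| <= eta) ->
  `|conv f k z - c * \int[mu]_w k (z - w)| <= eta * \int[mu]_w k (z - w).
Proof.
move=> kk k0 intf ik fc.
have iZ (a : R) : mu.-integrable setT (EFin \o (fun w => a * k (z - w))).
  exact: (@integrableZl _ _ _ mu setT measurableT a _ ik).
have ifk := conv_integrable z kk intf.
have iB : mu.-integrable setT (EFin \o (fun w => f w * k (z - w) - c * k (z - w))).
  exact: (integrableB measurableT ifk (iZ c)).
have -> : conv f k z - c * \int[mu]_w k (z - w) =
    \int[mu]_w (f w * k (z - w) - c * k (z - w)).
  by rewrite (RintegralB measurableT ifk (iZ c)) (RintegralZl c measurableT ik).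
apply: (le_trans (le_normr_Rintegral measurableT iB)).
rewrite -(RintegralZl eta measurableT ik).
apply: (le_Rintegral measurableT (integrable_norm iB) (iZ eta)) => w _.
rewrite /= -mulrBl normrM (ger0_norm (k0 _)).
have [zw|zw] := pselect (cbox z d w); first by apply: (ler_wpM2r (k0 _)); exact: fc.
by rewrite (kernel_reflect_eq0 kk zw) !mulr0.
Qed.

(** Constant coefficients let the convolution pass through the operator, so the claim concerns the
    convolution of one function that is nonnegative almost everywhere. The factor [s] is later 1 or
    -1, for super- and subsolutions. *)
Lemma conv_super (s sigma r q : R) (B : set (R * R)) u ux uxx ut k d z :
  kernel d k -> (forall w, 0 <= k w) ->
  mu.-integrable setT (EFin \o (u \_ B)) ->
  mu.-integrable setT (EFin \o (ux \_ B)) ->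
  mu.-integrable setT (EFin \o (uxx \_ B)) ->
  mu.-integrable setT (EFin \o (ut \_ B)) ->
  {ae mu, forall z, B z -> 0 <= s * (ut z - opL sigma r q u ux uxx z)} ->
  0 <= s * (conv (ut \_ B) k z - (sigma ^+ 2 / 2 * conv (uxx \_ B) k z +
    (r - q - sigma ^+ 2 / 2) * conv (ux \_ B) k z - r * conv (u \_ B) k z)).
Proof.
move=> kk k0 iu iux iuxx iut pos.
have iZ (a : R) g : mu.-integrable setT (EFin \o g) ->
    mu.-integrable setT (EFin \o (a *: g)).
  by move=> ig; exact: (@integrableZl _ _ _ mu setT measurableT a _ ig).
have iD g1 g2 : mu.-integrable setT (EFin \o g1) -> mu.-integrable setT (EFin \o g2) ->
    mu.-integrable setT (EFin \o (g1 + g2)).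
  by move=> i1 i2; exact: (integrableD measurableT i1 i2).
have i3 := iD _ _ (iZ (- (s * (r - q - sigma ^+ 2 / 2))) _ iux) (iZ (s * r) _ iu).
have i2 := iD _ _ (iZ (- (s * (sigma ^+ 2 / 2))) _ iuxx) i3.
have ih := iD _ _ (iZ s _ iut) i2.
have := conv_ge0 z kk k0 ih.
rewrite (convD _ kk (iZ s _ iut) i2) (convD _ kk (iZ _ _ iuxx) i3).
rewrite (convD _ kk (iZ _ _ iux) (iZ _ _ iu)).
rewrite (convZ _ _ kk iut) (convZ _ _ kk iuxx) (convZ _ _ kk iux) (convZ _ _ kk iu).
move=> H; have {H} := H _.
rewrite [X in _ -> 0 <= X](_ : _ = s * conv (ut \_ B) k z +
  (- (s * (sigma ^+ 2 / 2)) * conv (uxx \_ B) k z +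
  (- (s * (r - q - sigma ^+ 2 / 2)) * conv (ux \_ B) k z +
    s * r * conv (u \_ B) k z))); last by ring.
apply; apply: (@filterS _ (almost_everywhere mu) (ae_filter_ringOfSetsType mu) _ _ _ pos) => w.
rewrite /opL => H.
have -> : (s *: ut \_ B + (- (s * (sigma ^+ 2 / 2)) *: uxx \_ B +
   (- (s * (r - q - sigma ^+ 2 / 2)) *: ux \_ B + (s * r) *: u \_ B))) w =
   s * (ut \_ B) w + (- (s * (sigma ^+ 2 / 2)) * (uxx \_ B) w +
   (- (s * (r - q - sigma ^+ 2 / 2)) * (ux \_ B) w + (s * r) * (u \_ B) w)) by [].
rewrite /patch; case: ifPn => [/set_mem wB|_]; last first.
  by rewrite (_ : point = 0)// !mulr0 !addr0.
move: (H wB); set L := (X in 0 <= X -> _); set L' := (X in _ -> 0 <= X).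
by have -> : L = L' by rewrite /L /L'; ring.
Qed.

End mollification.

(** * From weak inequalities to limits of classical supersolutions *)

Section smooth_approximation.
Context {R : realType}.
Variables (sigma r q : R).
Implicit Types (u ux uxx ut : R * R -> R) (z w : R * R).
Let mu : {measure set (measurableTypeR R * measurableTypeR R) -> \bar R} := leb2.

Lemma super_at_weak (s : R) (Omega B : set (R * R)) u ux uxx ut z0 (d : R) :
  0 < d -> B = cbox z0 d -> B `<=` Omega ->
  weak_derivative Omega dir_x u ux -> weak_derivative Omega dir_x ux uxx ->
  weak_derivative Omega dir_tau u ut ->
  mu.-integrable setT (EFin \o (u \_ B)) ->
  mu.-integrable setT (EFin \o (ux \_ B)) ->
  mu.-integrable setT (EFin \o (uxx \_ B)) ->
  mu.-integrable setT (EFin \o (ut \_ B)) ->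
  (forall z, B z -> {for z, continuous u}) ->
  {ae mu, forall z, B z -> 0 <= s * (ut z - opL sigma r q u ux uxx z)} ->
  super_at sigma r q (fun z => s * u z) z0.
Proof.
move=> d0 BE BO wx wxx wt iu iux iuxx iut cu pos.
have d20 : 0 < d / 2 by rewrite divr_gt0.
have sB : cbox z0 (d / 2) `<=` B by rewrite BE; apply: cbox_subset; lra.
exists (d / 2); [exact: d20|move=> eta eta0].
have s10 : 0 < 1 + `|s| by rewrite ltr_wpDr.
(* The error is multiplied by |s| in the end, and |s| / (1 + |s|) <= 1. *)
have se0 : 0 < eta / (1 + `|s|) by rewrite divr_gt0.
have [e1 e10 He] := @compact_uniform_cbox _ u (cbox z0 (d / 2)) (eta / (1 + `|s|))
  (@compact_cbox _ _ _) (fun z hz => cu z (sB z hz)) se0.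
(* Kernel radius: [e1] for uniform closeness, d / 2 so that squares centred in the half-size box
   stay in [B]. *)
pose e := Num.min e1 (d / 2).
have e0 : 0 < e by rewrite lt_min e10.
have ee1 : e <= e1 by rewrite /e ge_min lexx.
have cB z : cbox z0 (d / 2) z -> cbox z e `<=` B.
  move=> zK w zw; rewrite BE.
  have := cbox_cbox zK zw; apply: cbox_subset.
  by rewrite [leRHS](splitr d) lerD2l /e ge_min lexx orbT.
have kk := kernel_bump e0.
have kx := kernel_derive dir_x kk.
have kxx := kernel_derive dir_x kx.
have kt := kernel_derive dir_tau kk.
have k0 : forall w, 0 <= bump e w by exact: bump_ge0.
have M0 := bump_mass_gt0 e0.
have Mz z := bump_mass z e0.
have ik z := bump_integrable z e0.
move: (bump e) kk kx kxx kt k0 M0 Mz ik => k kk kx kxx kt k0.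
set M := (X in 0 < X) => M0 Mz ik.
have sM : 0 <= `|s| / M by rewrite divr_ge0 ?normr_ge0// ltW.
have cf : continuous (conv (u \_ B) k) by exact: conv_continuous kk iu.
have Zc (g : R -> R) (g' y : R) : is_derive y 1 g g' ->
    is_derive y 1 (fun y => s / M * g y) (s / M * g').
  by move=> dg; exact: (is_deriveZ (s / M) dg).
exists (fun z => s / M * conv (u \_ B) k z), (fun z => s / M * conv (u \_ B) ('D_dir_x k) z),
  (fun z => s / M * conv (u \_ B) ('D_dir_x ('D_dir_x k)) z),
  (fun z => s / M * conv (u \_ B) ('D_dir_tau k) z).
split.
- split=> [z|x t|x t|x t]; [|apply: Zc..].
  + by apply: cvgM; [exact: cvg_cst|exact: cf].
  + exact: (is_derive_conv_x _ _ kk).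
  + exact: (is_derive_conv_x _ _ kx).
  + exact: (is_derive_conv_t _ _ kk).
- move=> z zK.
  have H : forall w, cbox z e w -> `|(u \_ B) w - u z| <= eta / (1 + `|s|).
    move=> w zw; rewrite /patch ifT; last by apply/mem_set/(cB z).
    by apply: (He _ _ zK); exact: cbox_subset zw.
  have := conv_close kk k0 iu (ik z) H; rewrite Mz -/M => {}H.
  have -> : s / M * conv (u \_ B) k z - s * u z =
      s / M * (conv (u \_ B) k z - u z * M) by field; rewrite gt_eqF.
  rewrite normrM normf_div (gtr0_norm M0).
  apply: (le_trans (ler_wpM2l sM H)).
  have -> : `|s| / M * (eta / (1 + `|s|) * M) = eta * `|s| / (1 + `|s|).
    by field; rewrite !gt_eqF.
  by rewrite ler_pdivrMr// ler_wpM2l ?(ltW eta0)// lerDr.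
- move=> z zK.
  have zB := cB _ zK.
  have Et := weak_derivative_conv wt kk zB BO iu iut.
  have Ex := weak_derivative_conv wx kk zB BO iu iux.
  (* The second derivative moves from the kernel to the function one order at a time. *)
  have Exx := weak_derivative_conv wx kx zB BO iu iux.
  rewrite (weak_derivative_conv wxx kk zB BO iux iuxx) in Exx.
  have := conv_super z kk k0 iu iux iuxx iut pos.
  rewrite -Et -Ex -Exx /opL.
  move: (conv _ _ _) (conv _ _ _) (conv _ _ _) (conv _ _ _) => c1 c2 c3 c4 H.
  have := mulr_ge0 H (ltW _ : 0 <= M^-1); rewrite invr_gt0 => /(_ M0).
  set L := (X in 0 <= X -> _); set L' := (X in _ -> 0 <= X).
  by have -> : L = L' by rewrite /L /L'; ring.
Qed.

End smooth_approximation.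

(** * Comparison with smooth functions *)

Section touching.
Context {R : realType}.
Implicit Types (f g : R -> R).

(** The increment has the sign of l h; the product form covers both signs of [l] and of [h]. *)
Lemma is_derive_sign f (c l : R) : is_derive c 1 f l -> l != 0 ->
  exists2 e, 0 < e & forall h : R, h != 0 -> `|h| < e -> 0 < l * (h * (f (c + h) - f c)).
Proof.
move=> [df dfl] l0.
have /cvgrPdist_lt/(_ `|l|) : h^-1 *: (f (h *: 1 + c) - f c) @[h --> 0^'] --> l.
  by rewrite -dfl; exact: df.
rewrite normr_gt0 => /(_ l0); rewrite /dnbhs /within/= => /nbhs_ballP[e /= e0 He].
exists e => // h h0 he.
have := He h; rewrite /ball/= sub0r normrN => /(_ he h0).
rewrite /GRing.scale/= mulr1 (addrC h).
set D := f (c + h) - f c => H.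
have hh : 0 < h ^+ 2 by rewrite exprn_even_gt0.
have -> : l * (h * D) = h ^+ 2 * (l * (h^-1 * D)) by field.
rewrite mulr_gt0//.
move: (h^-1 * D) H => a; have [l1|l1|l1] := ltgtP l 0; last by rewrite l1 eqxx in l0.
- rewrite (ltr0_norm l1) ltr_norml => /andP[H1 H2]; nra.
- rewrite (gtr0_norm l1) ltr_norml => /andP[H1 H2]; nra.
Qed.

(** If l < 0, then f' < 0 just to the right of [c], and the mean value theorem produces a value
    below f(c). *)
Lemma second_derivative_min f f' (c l e : R) : 0 < e ->
  (forall x : R, is_derive x 1 f (f' x)) -> is_derive c 1 f' l ->
  (forall x, `|x - c| < e -> f c <= f x) -> f' c = 0 /\ 0 <= l.
Proof.
move=> e0 df df' fc.
have f'c : f' c = 0.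
  apply/eqP/negP => /negP n0; have [d d0 Hd] := is_derive_sign (df c) n0.
  (* A small step against the slope. *)
  pose h := Num.min d e / 2 * (- Num.sg (f' c)).
  have m0 : 0 < Num.min d e by rewrite lt_min d0.
  have hE : `|h| = Num.min d e / 2.
    by rewrite normrM normrN normr_sg n0 mulr1 gtr0_norm// divr_gt0.
  have hn : h != 0 by rewrite -normr_gt0 hE divr_gt0.
  have hm : `|h| < Num.min d e by rewrite hE ltr_pdivrMr// ltr_pMr// ltr1n.
  move: hm; rewrite lt_min => /andP[hd he].
  have := Hd _ hn hd; have := fc (c + h); rewrite addrC addKr => /(_ he).
  rewrite addrC => H1 H2; move: H2; rewrite /h mulrA.
  have : f' c * (Num.min d e / 2 * - Num.sg (f' c)) = - (`|f' c| * (Num.min d e / 2)).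
    by rewrite normrEsg; ring.
  move=> ->; rewrite mulNr oppr_gt0 ltNge mulr_ge0 ?subr_ge0//.
  by rewrite mulr_ge0// ltW// divr_gt0.
split=> //; rewrite leNgt; apply/negP => l0.
have [d d0 Hd] := is_derive_sign df' (ltr0_neq0 l0).
pose h := Num.min d e / 2.
have m0 : 0 < Num.min d e by rewrite lt_min d0.
have h0 : 0 < h by rewrite divr_gt0.
have : h < Num.min d e by rewrite ltr_pdivrMr// ltr_pMr// ltr1n.
rewrite lt_min => /andP[hd he].
have ch : c < c + h by rewrite ltrDl.
have cf : {within `[c, c + h], continuous f}.
  by apply: derivable_within_continuous => w _; have [] := df w.
have [x] := MVT ch (fun w _ => df w) cf.
rewrite in_itv/= => /andP[cx xh] fE.
have f'x : f' x < 0.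
  have xc0 : 0 < x - c by rewrite subr_gt0.
  have := Hd (x - c); rewrite gt_eqF// gtr0_norm// f'c subr0 (addrC c) subrK.
  move=> /(_ erefl); have -> : x - c < d by lra.
  by move=> /(_ erefl); rewrite nmulr_rgt0// pmulr_rlt0.
have := fc (c + h); rewrite (addrC c) addrK gtr0_norm// => /(_ he).
rewrite (addrC h) -subr_ge0 fE (addrC c) addrK leNgt => /negP; apply.
by rewrite pmulr_llt0.
Qed.

(** For the time variable: a parabolic minimum is compared with earlier times only. *)
Lemma derivative_left_min f (c l e : R) : 0 < e -> is_derive c 1 f l ->
  (forall x, c - e < x <= c -> f c <= f x) -> l <= 0.
Proof.
move=> e0 df fc; rewrite leNgt; apply/negP => l0.
have [d d0 Hd] := is_derive_sign df (lt0r_neq0 l0).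
pose h := Num.min d e / 2.
have m0 : 0 < Num.min d e by rewrite lt_min d0.
have h0 : 0 < h by rewrite divr_gt0.
have : h < Num.min d e by rewrite ltr_pdivrMr// ltr_pMr// ltr1n.
rewrite lt_min => /andP[hd he].
have := Hd (- h); rewrite oppr_eq0 gt_eqF// normrN gtr0_norm// => /(_ erefl hd).
rewrite pmulr_rgt0// nmulr_rgt0 ?oppr_lt0// subr_lt0 ltNge fc//.
by apply/andP; split; lra.
Qed.

Lemma is_derive_quadratic (a0 a1 a2 x0 x : R) :
  is_derive x 1 (fun y => a0 + a1 * (y - x0) + a2 * (y - x0) ^+ 2)
    (a1 + 2 * a2 * (x - x0)).
Proof.
pose P : {poly R} := a0%:P + a1%:P * ('X - x0%:P) + a2%:P * ('X - x0%:P) ^+ 2.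
have -> : (fun y => a0 + a1 * (y - x0) + a2 * (y - x0) ^+ 2) = horner P.
  by apply/funext => y; rewrite /P !(hornerD, hornerM, hornerC, hornerN, hornerX, expr2).
apply: (is_derive_eq (is_derive_poly P x)).
rewrite /P !expr2 !(derivD, derivM, derivN, derivC, derivX) !(hornerD, hornerM, hornerC, hornerN, hornerX).
by ring.
Qed.

End touching.

Section comparison.
Context {R : realType}.
Variables (sigma r q : R).
Hypothesis r0 : 0 < r.
Implicit Types (u phi phix phixx phit : R * R -> R) (z w : R * R).

Let mu := r - q - sigma ^+ 2 / 2.

Tactic Notation "lra_from" hyp_list(hs) :=
  revert hs; clear - R sigma r q r0 mu; intros; lra.

(* The approximations U of u are compared with phi - k ((x - x0)^2 + t0 - t), so
   that U minus this function is minimal off the parabolic boundary. *)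
Lemma super_touch u z0 phi phix phixx phit (m c d : R) : 0 < c -> 0 < d ->
  super_at sigma r q u z0 -> C21 phi phix phixx phit ->
  (forall w, cbox z0 d w -> w.2 <= z0.2 -> m <= u w - phi w) ->
  u z0 - phi z0 = m ->
  (forall w, cbox z0 d w -> w.2 <= z0.2 ->
    phit w - opL sigma r q phi phix phixx w + r * m <= - c) -> False.
Proof.
move=> c0 d0 [d1 d10 Hu] [cphi dx dxx dt] um uz Pphi.
pose e := Num.min d d1.
have e0 : 0 < e by rewrite lt_min d0.
have ed : e <= d by rewrite /e ge_min lexx.
have ed1 : e <= d1 by rewrite /e ge_min lexx orbT.
case: z0 um uz Pphi Hu => x0 t0 /= um uz Pphi Hu.
(* Up to the zero-order term, the correction adds at most k A to phi_t - L phi: k from the time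
   derivative, k sigma^2 and 2 k |mu| e from those in space. Then [k] is fixed by k A = c / 4. *)
pose A := 1 + sigma ^+ 2 + 2 * `|mu| * e.
have A0 : 0 < A.
  rewrite /A; have := sqr_ge0 sigma; have := mulr_ge0 (normr_ge0 mu) (ltW e0); lra.
pose k := c / (4 * A).
have k0 : 0 < k by rewrite divr_gt0// mulr_gt0.
have kA : k * A = c / 4 by rewrite /k; field; rewrite gt_eqF.
(* At the minimum, k ((x - x0)^2 + t0 - t) <= 2 eta. The first two bounds keep it off the lateral
   sides and the bottom; the third gives r eta <= c / 4, so that the errors total at most c / 2. *)
pose eta := Num.min (Num.min (k * e ^+ 2 / 4) (k * e / 4)) (c / (4 * r)).
have eta0 : 0 < eta.
  rewrite !lt_min; apply/andP; split; first (apply/andP; split).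
  - by rewrite divr_gt0// mulr_gt0// exprn_gt0.
  - by rewrite divr_gt0// mulr_gt0.
  - by rewrite divr_gt0// mulr_gt0.
have [eta1 eta2 eta3] : [/\ eta <= k * e ^+ 2 / 4, eta <= k * e / 4 & r * eta <= c / 4].
  split.
  - by rewrite /eta !ge_min lexx.
  - by rewrite /eta !ge_min lexx orbT.
  - have : eta <= c / (4 * r) by rewrite /eta ge_min lexx orbT.
    by rewrite ler_pdivlMr ?mulr_gt0// => H; rewrite ler_pdivlMr//; lra.
have [U [Ux [Uxx [Ut [[cU dUx dUxx dUt] UE PU]]]]] := Hu _ eta0.
pose psi w := phi w - k * ((w.1 - x0) ^+ 2 + (t0 - w.2)).
pose K : set (R * R) := (`[x0 - e, x0 + e] `*` `[t0 - e, t0])%classic.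
have KE w : K w -> [/\ cbox (x0, t0) e w, `|w.1 - x0| <= e & t0 - e <= w.2 <= t0].
  rewrite /K/= !in_itv/= -ler_distl => -[w1 /andP[w2 w3]].
  split=> //; last by rewrite w2.
  by split => //=; rewrite ler_distl; apply/andP; split; lra_from w2 w3 e0.
have cK : compact K by apply: compact_setX; exact: segment_compact.
have Kz : K (x0, t0).
  by rewrite /K/= !in_itv/=; split; apply/andP; split; lra_from e0.
have cg : {within K, continuous (fun w => U w - psi w)}.
  apply: continuous_subspaceT => w; apply: cvgB; first exact: cU.
  apply: cvgB; first exact: cphi.
  apply: cvgM; first exact: cvg_cst.
  apply: cvgD.
    apply: (@cvg_comp _ _ _ (fun w : R * R => w.1 - x0) (fun y : R => y ^+ 2)).
      by apply: cvgB; [exact: cvg_fst|exact: cvg_cst].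
    exact: exprn_continuous.
  by apply: cvgB; [exact: cvg_cst|exact: cvg_snd].
have [[x1 t1] /set_mem z1K z1min] :=
  compact_EVT_min (ex_intro _ _ Kz) cK cg.
have [z0b _ _] := KE _ Kz.
have [z1b x1e /= /andP[t1e t1t]] := KE _ z1K; rewrite /= in x1e.
have Uz0 : U (x0, t0) - psi (x0, t0) <= m + eta.
  have := UE _ (cbox_subset ed1 z0b); rewrite ler_norml => /andP[_ h].
  by rewrite /psi/= !subrr expr0n/= addr0 mulr0 subr0; lra_from h uz.
have z1d : cbox (x0, t0) d (x1, t1) := cbox_subset ed z1b.
have z1d1 : cbox (x0, t0) d1 (x1, t1) := cbox_subset ed1 z1b.
have mz1 := um _ z1d t1t.
have [Ul Ug] : - eta <= U (x1, t1) - u (x1, t1) /\ U (x1, t1) - u (x1, t1) <= eta.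
  by have := UE _ z1d1; rewrite ler_norml => /andP.
have zmin w : K w -> U (x1, t1) - psi (x1, t1) <= U w - psi w.
  by move=> Kw; apply: z1min; rewrite inE.
have z01 := zmin _ Kz.
have y2 := sqr_ge0 (x1 - x0).
have psi1 : psi (x1, t1) = phi (x1, t1) - k * (x1 - x0) ^+ 2 - k * (t0 - t1).
  by rewrite /psi/=; ring.
have ky2 := mulr_ge0 (ltW k0) y2.
have kt : 0 <= k * (t0 - t1) by rewrite mulr_ge0 ?(ltW k0)// subr_ge0.
have x1lt : `|x1 - x0| < e.
  rewrite -(ltr_pXn2r (n := 2))// ?nnegrE// ?(ltW e0)// (real_normK (num_real _)).
  rewrite -(ltr_pM2l k0); have : 0 < k * e ^+ 2 by rewrite mulr_gt0// exprn_gt0.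
  lra_from z01 Uz0 psi1 mz1 Ul kt eta1.
have t1lt : t0 - e < t1.
  have ke0 : 0 < k * e by rewrite mulr_gt0.
  have : k * (t0 - t1) < k * e by lra_from z01 Uz0 psi1 mz1 Ul ky2 eta2 ke0.
  by rewrite ltr_pM2l// => H; lra_from H.
have dpsi (x : R) : is_derive x 1 (fun y => U (y, t1) - psi (y, t1))
    (Ux (x, t1) - (phix (x, t1) - (0 + 2 * k * (x - x0)))).
  have -> : (fun y => U (y, t1) - psi (y, t1)) = (fun y => U (y, t1)) -
      ((fun y => phi (y, t1)) - (fun y => k * (t0 - t1) + 0 * (y - x0) + k * (y - x0) ^+ 2)).
    by apply/funext => y; rewrite !fctE /psi/=; ring.
  exact: (is_deriveB (dUx x t1) (is_deriveB (dx x t1) (is_derive_quadratic _ _ _ _ _))).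
have dpsi2 : is_derive x1 1 (fun x => Ux (x, t1) - (phix (x, t1) - (0 + 2 * k * (x - x0))))
    (Uxx (x1, t1) - (phixx (x1, t1) - (2 * k + 2 * 0 * (x1 - x0)))).
  have -> : (fun x => Ux (x, t1) - (phix (x, t1) - (0 + 2 * k * (x - x0)))) =
      (fun y => Ux (y, t1)) - ((fun y => phix (y, t1)) -
      (fun y => 0 + (2 * k) * (y - x0) + 0 * (y - x0) ^+ 2)).
    by apply/funext => y; rewrite !fctE /=; ring.
  exact: (is_deriveB (dUxx x1 t1) (is_deriveB (dxx x1 t1) (is_derive_quadratic _ _ _ _ _))).
have dpsit : is_derive t1 1 (fun s => U (x1, s) - psi (x1, s))
    (Ut (x1, t1) - (phit (x1, t1) - (- k + 2 * 0 * (t1 - t0)))).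
  have -> : (fun s => U (x1, s) - psi (x1, s)) = (fun s => U (x1, s)) -
      ((fun s => phi (x1, s)) - (fun s => k * (x1 - x0) ^+ 2 + (- k) * (s - t0) + 0 * (s - t0) ^+ 2)).
    by apply/funext => y; rewrite !fctE /psi/=; ring.
  exact: (is_deriveB (dUt x1 t1) (is_deriveB (dt x1 t1) (is_derive_quadratic _ _ _ _ _))).
have e1 : 0 < e - `|x1 - x0| by rewrite subr_gt0.
have e2 : 0 < t1 - (t0 - e) by rewrite subr_gt0.
have Kx x : `|x - x1| < e - `|x1 - x0| -> K (x, t1).
  move=> H; rewrite /K/= !in_itv/= t1t (ltW t1lt) -ler_distl; split=> //.
  have -> : x - x0 = (x - x1) + (x1 - x0) by ring.
  by rewrite (le_trans (ler_normD _ _))//; lra_from H.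
have Kt s : t1 - (t1 - (t0 - e)) < s <= t1 -> K (x1, s).
  move=> /andP[H1 H2]; rewrite /K/= !in_itv/= -ler_distl x1e; split=> //.
  by apply/andP; split; [lra_from H1|lra_from H2 t1t].
have [fx fxx] := second_derivative_min e1 dpsi dpsi2 (fun x hx => zmin _ (Kx x hx)).
have ft := derivative_left_min e2 dpsit (fun s hs => zmin _ (Kt s hs)).
have := PU _ z1d1; have := Pphi _ z1d t1t; rewrite /opL -/mu.
have UxE : Ux (x1, t1) = phix (x1, t1) - 2 * k * (x1 - x0) by lra_from fx.
have s2 := sqr_ge0 sigma.
have Uxx2 : sigma ^+ 2 / 2 * (phixx (x1, t1) - 2 * k) <= sigma ^+ 2 / 2 * Uxx (x1, t1).
  by apply: ler_wpM2l; [lra_from s2|lra_from fxx].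
have rU : r * U (x1, t1) <= r * (phi (x1, t1) + m + eta).
  by rewrite ler_pM2l//; lra_from z01 Uz0 psi1 mz1 ky2 kt.
have muy : - (mu * (2 * k * (x1 - x0))) >= - (2 * k * (`|mu| * e)).
  have k20 : 0 < 2 * k by rewrite mulr_gt0.
  rewrite lerN2 (le_trans (ler_norm _))// normrM normrM (gtr0_norm k20).
  by rewrite mulrCA (ler_pM2l k20) ler_wpM2l.
rewrite UxE => H1 H2.
have : c <= k * A + r * eta by rewrite /A; lra_from H1 H2 Uxx2 rU muy ft s2.
by rewrite kA => H; lra_from H eta3 c0.
Qed.

(** At a negative minimum m of u - phi, phi + m touches u from below, and it is still a strict
    subsolution since r m <= 0. The supersolution property is asked only where u < phi, which is
    what makes the lemma applicable to [-Y]. *)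
Lemma super_comparison u phi phix phixx phit (a b s t c : R) : 0 < c ->
  let K := [set w : R * R | a <= w.1 <= b /\ s <= w.2 <= t] in
  {within K, continuous u} -> C21 phi phix phixx phit ->
  (forall w, K w -> phit w - opL sigma r q phi phix phixx w <= - c) ->
  (forall w, K w -> [\/ w.1 = a, w.1 = b | w.2 = s] -> phi w <= u w) ->
  (forall w, a < w.1 < b -> s < w.2 <= t -> u w < phi w -> super_at sigma r q u w) ->
  forall w, K w -> phi w <= u w.
Proof.
move=> c0 K cu cphi Pphi bd su z0 Kz0.
have KE : K = (`[a, b] `*` `[s, t])%classic.
  by apply/seteqP; split => -[x y]; rewrite /K/= !in_itv.
have cK : compact K by rewrite KE; apply: compact_setX; exact: segment_compact.
have cg : {within K, continuous (fun w => u w - phi w)}.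
  move=> w; apply: cvgB; first exact: cu.
  by apply: (continuous_subspaceT (A := K)); case: cphi.
have [z Kz zmin] := compact_EVT_min (ex_intro _ _ Kz0) cK cg.
have {Kz} Kz := set_mem Kz; have {}zmin w : K w -> u z - phi z <= u w - phi w.
  by move=> Kw; apply: zmin; rewrite inE.
rewrite -subr_ge0; apply: le_trans (zmin _ Kz0).
rewrite leNgt; apply/negP => m0.
have m0' : u z < phi z by rewrite -subr_lt0.
case: (Kz) => /andP[az zb] /andP[sz zt].
have {}az : a < z.1.
  rewrite lt_neqAle az andbT; apply/eqP => E.
  by move: m0'; rewrite ltNge bd//; constructor 1.
have {}zb : z.1 < b.
  rewrite lt_neqAle zb andbT; apply/eqP => E.
  by move: m0'; rewrite ltNge bd//; constructor 2.
have {}sz : s < z.2.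
  rewrite lt_neqAle sz andbT; apply/eqP => E.
  by move: m0'; rewrite ltNge bd//; constructor 3.
pose d := Num.min (Num.min (z.1 - a) (b - z.1)) (z.2 - s).
have d0 : 0 < d by rewrite !lt_min !subr_gt0 az zb sz.
have [d1 d2 d3] : [/\ d <= z.1 - a, d <= b - z.1 & d <= z.2 - s].
  by split; rewrite /d !ge_min lexx ?orbT.
have KK w : cbox z d w -> w.2 <= z.2 -> K w.
  move=> [w1 w2] wz; rewrite !ler_distl in w1 w2.
  case/andP: w1 => l1 u1; case/andP: w2 => l2 u2.
  by split; apply/andP; split; lra_from l1 u1 l2 u2 d1 d2 d3 wz zt.
apply: (super_touch c0 d0 _ cphi (fun w h1 h2 => zmin w (KK w h1 h2)) erefl) => //.
  by apply: su => //; rewrite ?az ?zb ?sz ?zt.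
move=> w h1 h2; have := Pphi _ (KK w h1 h2).
have : r * (u z - phi z) <= 0 by rewrite pmulr_rle0// ltW.
lra.
Qed.

End comparison.

(** * Strong solutions as limits of classical supersolutions *)

Section strong_solutions.
Context {R : realType}.
Variables (K1 k2 K2 sigma r q T : R).
Implicit Types (u Y : R * R -> R) (z w : R * R) (d : R).

(** Points of the square have tau >= m / 2, so it avoids the disc of radius m / 2 about the corner
    (ln K2, 0), and the L^p bounds hold on it. *)
Lemma openQ_cbox z0 : openQ k2 T z0 ->
  exists2 d, 0 < d & cbox z0 d `<=` openQ k2 T /\
    exists rad rho, [/\ 0 < rad, 0 < rho & cbox z0 d `<=` truncQ k2 K2 T rad rho].
Proof.
move=> [z1 /andP[z2 z3]].
pose m := Num.min (Num.min (z0.1 - ln k2) z0.2) (T - z0.2).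
have m0 : 0 < m by rewrite !lt_min !subr_gt0 z1 z2 z3.
have [m1 m2 m3] : [/\ m <= z0.1 - ln k2, m <= z0.2 & m <= T - z0.2].
  by split; rewrite /m !ge_min lexx ?orbT.
have sub : cbox z0 (m / 2) `<=` [set w | [/\ ln k2 < w.1, m / 2 <= w.2 & w.2 < T]].
  move=> w [w1 w2]; rewrite !ler_distl in w1 w2.
  by case/andP: w1 => ? ?; case/andP: w2 => ? ?; split; lra.
exists (m / 2); first lra.
split.
  by move=> w /sub[h1 h2 h3]; split=> //; apply/andP; split; lra.
exists (`|z0.1| + m), (m / 2); split; [by have := normr_ge0 z0.1; lra|lra|].
move=> w zw; have [h1 h2 h3] := sub _ zw; split.
  split=> //; last by apply/andP; split; lra.
  rewrite -ltr_norml -[w.1](subrK z0.1) addrC (le_lt_trans (ler_normD _ _))//.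
  by rewrite ltrD2l; case: zw => zw _; lra.
rewrite /disc/= subr0 => H.
have : (m / 2) ^+ 2 <= w.2 ^+ 2 by rewrite ler_sqr ?nnegrE//; lra.
by have := sqr_ge0 (w.1 - ln K2); lra.
Qed.

Lemma openQ_subset_clQ : openQ k2 T `<=` clQ k2 T.
Proof. by move=> z [z1 /andP[z2 z3]]; split; [lra|apply/andP; split; lra]. Qed.

Lemma openQ_continuous Y z : {within clQ k2 T, continuous Y} -> openQ k2 T z ->
  {for z, continuous Y}.
Proof.
move=> cY zQ; have /subspace_continuousP/(_ z) := cY.
move=> /(_ (openQ_subset_clQ zQ)); rewrite within_interior//.
have [d d0 [dQ _]] := openQ_cbox zQ.
apply: filterS (cbox_nbhs z d0); exact: subset_trans dQ openQ_subset_clQ.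
Qed.

Lemma psi2_continuous : continuous (psi2 K1 k2 K2).
Proof.
move=> x; apply: cvgB; last exact: cvg_cst.
apply: cvgD; last exact: cvg_cst.
apply: (@continuous_max _ _ (fun x => K2 - expR x) (cst 0)).
  by apply: cvgB; [exact: cvg_cst|exact: continuous_expR].
exact: cvg_cst.
Qed.

Lemma super_at_ext u v z : u =1 v -> super_at sigma r q u z -> super_at sigma r q v z.
Proof. by move=> /funext ->. Qed.

Lemma strong_solution_super p Y z : 1 < p ->
  strong_solution K1 k2 K2 sigma r q T p Y -> openQ k2 T z ->
  super_at sigma r q Y z /\
  (psi2 K1 k2 K2 z.1 < Y z -> super_at sigma r q (fun w => - Y w) z).
Proof.
move=> p1 [Yx [Yxx [Yt [[cY [wx wxx wt] Lp] [Yge Ypos Yeq _ _]]]]] zQ.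
have [d d0 [dQ [rad [rho [rad0 rho0 dtr]]]]] := openQ_cbox zQ.
have [L1 L2 L3 L4] := Lp _ _ rad0 rho0.
have inQ e : e <= d -> cbox z e `<=` openQ k2 T.
  by move=> ed; apply: subset_trans dQ; exact: cbox_subset.
have int e u : 0 < e -> e <= d -> in_Lp p (truncQ k2 K2 T rad rho) u ->
    leb2.-integrable setT (EFin \o (u \_ (cbox z e))).
  move=> e0 ed Lu; apply: (in_Lp_integrable (ltW p1) Lu).
  - exact: measurable_cbox.
  - by rewrite [X in (X < _)%E]leb2_cbox ?ltry// ltW.
  - by apply: subset_trans dtr; exact: cbox_subset.
have main s e : 0 < e -> e <= d ->
    {ae leb2, forall w, cbox z e w -> 0 <= s * (Yt w - opL sigma r q Y Yx Yxx w)} ->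
    super_at sigma r q (fun w => s * Y w) z.
  move=> e0 ed; apply: (super_at_weak e0 erefl (inQ e ed) wx wxx wt).
  - exact: int.
  - exact: int.
  - exact: int.
  - exact: int.
  - by move=> w /(inQ _ ed); exact: openQ_continuous.
have Qdom w : openQ k2 T w -> domQ k2 T w.
  by move=> [w1 /andP[w2 w3]]; split=> //; rewrite w2 ltW.
split.
  apply: (@super_at_ext (fun w => 1 * Y w)); first by move=> w; rewrite mul1r.
  apply: (main _ d) => //.
  apply: (@filterS _ (almost_everywhere leb2) (ae_filter_ringOfSetsType leb2) _ _ _ Ypos).
  by move=> w Hw /dQ/Qdom/Hw; rewrite mul1r.
move=> Yz.
have [d1 d10 dY] : exists2 d1, 0 < d1 & cbox z d1 `<=` [set w | psi2 K1 k2 K2 w.1 < Y w].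
  have c1 := openQ_continuous cY zQ.
  have c2 : psi2 K1 k2 K2 w.1 @[w --> z] --> psi2 K1 k2 K2 z.1.
    by apply: cvg_comp; [exact: cvg_fst|exact: psi2_continuous].
  have c3 : (Y w - psi2 K1 k2 K2 w.1) @[w --> z] --> Y z - psi2 K1 k2 K2 z.1.
    exact: cvgB.
  have /nbhs_cbox[e e0 He] : \forall w \near z, 0 < Y w - psi2 K1 k2 K2 w.1.
    by apply: (cvgr_gt _ c3); rewrite subr_gt0.
  by exists e => // w /He /=; rewrite subr_gt0.
pose e := Num.min d d1.
have e0 : 0 < e by rewrite lt_min d0.
have ed : e <= d by rewrite /e ge_min lexx.
have ed1 : e <= d1 by rewrite /e ge_min lexx orbT.
apply: (@super_at_ext (fun w => -1 * Y w)); first by move=> w; rewrite mulN1r.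
apply: (main _ e) => //.
apply: (@filterS _ (almost_everywhere leb2) (ae_filter_ringOfSetsType leb2) _ _ _ Yeq).
move=> w Hw we.
rewrite Hw ?mulr0//; first exact/Qdom/(inQ _ ed).
exact/dY/(cbox_subset ed1).
Qed.

End strong_solutions.

(** * Barriers *)

Section barriers.
Context {R : realType}.
Implicit Types (x t : R).

(** With a0 = K2 + k2 - K1 and b = -1 this is G plus a quadratic polynomial; opposite signs serve
    comparisons with [-Y]. *)
Lemma C21_quadratic_exp (a0 a1 a2 x0 b a3 : R) :
  C21 (fun z : R * R => a0 + a1 * (z.1 - x0) + a2 * (z.1 - x0) ^+ 2 + b * expR z.1 + a3 * z.2)
      (fun z => a1 + 2 * a2 * (z.1 - x0) + b * expR z.1)
      (fun z => 2 * a2 + b * expR z.1)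
      (fun z => a3).
Proof.
have dq c0 c1 c2 (x : R) := @is_derive_quadratic R c0 c1 c2 x0 x.
have de (x : R) : is_derive x 1 (b *: expR) (b *: expR x).
  exact: is_deriveZ (is_derive_expR x).
split.
- move=> z; have ce : expR w.1 @[w --> z] --> expR z.1.
    by apply: (@cvg_comp _ _ _ fst expR); [exact: cvg_fst|exact: continuous_expR].
  have cx : w.1 - x0 @[w --> z] --> z.1 - x0.
    by apply: cvgB; [exact: cvg_fst|exact: cvg_cst].
  apply: cvgD; last by apply: cvgM; [exact: cvg_cst|exact: cvg_snd].
  apply: cvgD; last by apply: cvgM; [exact: cvg_cst|exact: ce].
  apply: cvgD.
    by apply: cvgD; [exact: cvg_cst|apply: cvgM; [exact: cvg_cst|exact: cx]].
  apply: cvgM; first exact: cvg_cst.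
  rewrite expr2; under eq_fun do rewrite expr2.
  by apply: cvgM; exact: cx.
- move=> x t.
  have -> : (fun y => a0 + a1 * ((y, t).1 - x0) + a2 * ((y, t).1 - x0) ^+ 2 +
      b * expR (y, t).1 + a3 * (y, t).2) =
      (fun y => (a0 + a3 * t) + a1 * (y - x0) + a2 * (y - x0) ^+ 2) + (b *: expR).
    by apply/funext => y; rewrite !fctE /GRing.scale/=; ring.
  exact: is_deriveD (dq _ _ _ x) (de x).
- move=> x t.
  have -> : (fun y => a1 + 2 * a2 * ((y, t).1 - x0) + b * expR (y, t).1) =
      (fun y => a1 + (2 * a2) * (y - x0) + 0 * (y - x0) ^+ 2) + (b *: expR).
    by apply/funext => y; rewrite !fctE /GRing.scale/=; ring.
  apply: (is_derive_eq (is_deriveD (dq _ _ _ x) (de x))).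
  by rewrite /GRing.scale/=; ring.
- move=> x t.
  have -> : (fun s => a0 + a1 * ((x, s).1 - x0) + a2 * ((x, s).1 - x0) ^+ 2 +
      b * expR (x, s).1 + a3 * (x, s).2) =
      (fun s => (a0 + a1 * (x - x0) + a2 * (x - x0) ^+ 2 + b * expR x + a3 * x0) +
        a3 * (s - x0) + 0 * (s - x0) ^+ 2).
    by apply/funext => y /=; ring.
  by apply: (is_derive_eq (dq _ _ _ t)); ring.
Qed.

Lemma is_derive_expR_affine (e a b y : R) :
  is_derive y 1 (fun y => e * expR (a * y + b)) (e * a * expR (a * y + b)).
Proof.
have d1 : is_derive y 1 (fun y => a * y + b) a.
  have -> : (fun y => a * y + b) = (fun y => b + a * (y - 0) + 0 * (y - 0) ^+ 2).
    by apply/funext => x; ring.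
  by apply: (is_derive_eq (is_derive_quadratic _ _ _ _ _)); ring.
have d2 : is_derive y 1 (expR \o (fun y => a * y + b)) (expR (a * y + b) * a).
  by apply: is_derive1_comp; exact: is_derive_expR.
apply: (is_derive_eq (is_deriveZ e d2)).
by rewrite /GRing.scale/=; ring.
Qed.

Lemma C21_travelling_exp (e a b c0 : R) :
  C21 (fun z : R * R => e * (expR (a * z.1 + b * z.2 + c0) - 1))
      (fun z => e * a * expR (a * z.1 + b * z.2 + c0))
      (fun z => e * a * a * expR (a * z.1 + b * z.2 + c0))
      (fun z => e * b * expR (a * z.1 + b * z.2 + c0)).
Proof.
split.
- move=> z; apply: cvgM; first exact: cvg_cst.
  apply: cvgB; last exact: cvg_cst.
  apply: (@cvg_comp _ _ _ (fun z : R * R => a * z.1 + b * z.2 + c0) expR).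
    apply: cvgD; last exact: cvg_cst.
    by apply: cvgD; apply: cvgM; [exact: cvg_cst|exact: cvg_fst|exact: cvg_cst|exact: cvg_snd].
  exact: continuous_expR.
- move=> x t.
  have -> : (fun y => e * (expR (a * (y, t).1 + b * (y, t).2 + c0) - 1)) =
      (fun y => e * expR (a * y + (b * t + c0))) + cst (- e).
    by apply/funext => y; rewrite !fctE/= addrA; ring.
  apply: (is_derive_eq (is_deriveD (is_derive_expR_affine _ _ _ _) (is_derive_cst _ _ _))).
  by rewrite addr0 addrA.
- move=> x t.
  have -> : (fun y => e * a * expR (a * (y, t).1 + b * (y, t).2 + c0)) =
      (fun y => e * a * expR (a * y + (b * t + c0))).
    by apply/funext => y; rewrite /= addrA.
  apply: (is_derive_eq (is_derive_expR_affine _ _ _ _)).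
  by rewrite addrA.
- move=> x t.
  have -> : (fun s => e * (expR (a * (x, s).1 + b * (x, s).2 + c0) - 1)) =
      (fun s => e * expR (b * s + (a * x + c0))) + cst (- e).
    by apply/funext => y; rewrite !fctE/= addrCA addrA; ring.
  apply: (is_derive_eq (is_deriveD (is_derive_expR_affine _ _ _ _) (is_derive_cst _ _ _))).
  by rewrite addr0 addrCA addrA.
Qed.

(** A bump on the tube |x - l| <= rho, decaying in time. It vanishes on the sides, and the square
    makes it convex there, hence a subsolution up to the sides once [K] is large. *)
Lemma C21_tube (e K l rho : R) :
  C21 (fun z : R * R => e * expR (- K * z.2 + 0) * (rho ^+ 2 - (z.1 - l) ^+ 2) ^+ 2)
      (fun z => e * expR (- K * z.2 + 0) * (- 4 * (z.1 - l) * (rho ^+ 2 - (z.1 - l) ^+ 2)))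
      (fun z => e * expR (- K * z.2 + 0) * (8 * rho ^+ 2 - 12 * (rho ^+ 2 - (z.1 - l) ^+ 2)))
      (fun z => - K * (e * expR (- K * z.2 + 0) * (rho ^+ 2 - (z.1 - l) ^+ 2) ^+ 2)).
Proof.
pose P : {poly R} := (rho ^+ 2)%:P - ('X - l%:P) * ('X - l%:P).
have PE x : P.[x] = rho ^+ 2 - (x - l) ^+ 2.
  by rewrite /P !(hornerD, hornerM, hornerC, hornerN, hornerX) expr2.
have P'E x : P^`().[x] = - 2 * (x - l).
  rewrite /P !(derivD, derivM, derivN, derivC, derivX) !(hornerD, hornerM, hornerC, hornerN, hornerX).
  by ring.
clearbody P.
have dPP c (x : R) (Q : {poly R}) : is_derive x 1 (c *: horner Q) (c *: Q^`().[x]).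
  exact: is_deriveZ (is_derive_poly Q x).
split.
- move=> z; apply: cvgM.
    apply: cvgM; first exact: cvg_cst.
    apply: (@cvg_comp _ _ _ (fun z : R * R => - K * z.2 + 0) expR).
      by apply: cvgD; [apply: cvgM; [exact: cvg_cst|exact: cvg_snd]|exact: cvg_cst].
    exact: continuous_expR.
  apply: (@cvg_comp _ _ _ fst (fun x => (rho ^+ 2 - (x - l) ^+ 2) ^+ 2)).
    exact: cvg_fst.
  have -> : (fun x => (rho ^+ 2 - (x - l) ^+ 2) ^+ 2) = horner (P * P).
    by apply/funext => x; rewrite hornerM PE expr2.
  have -> : (rho ^+ 2 - (z.1 - l) ^+ 2) ^+ 2 = (P * P).[z.1].
    by rewrite hornerM PE expr2.
  exact: continuous_horner.
- move=> x t.
  have -> : (fun y => e * expR (- K * (y, t).2 + 0) * (rho ^+ 2 - ((y, t).1 - l) ^+ 2) ^+ 2) =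
      (e * expR (- K * t + 0)) *: horner (P * P).
    by apply/funext => y; rewrite fctE hornerM PE /GRing.scale/= expr2.
  apply: (is_derive_eq (dPP _ _ _)).
  rewrite derivM !(hornerD, hornerM) PE P'E /GRing.scale/=; ring.
- move=> x t.
  have -> : (fun y => e * expR (- K * (y, t).2 + 0) *
      (- 4 * ((y, t).1 - l) * (rho ^+ 2 - ((y, t).1 - l) ^+ 2))) =
      (e * expR (- K * t + 0)) *: horner ((-4)%:P * ('X - l%:P) * P).
    apply/funext => y; rewrite fctE /GRing.scale/=.
    by rewrite !(hornerM, hornerD, hornerN, hornerC, hornerX) PE.
  apply: (is_derive_eq (dPP _ _ _)).
  rewrite !(derivM, derivD, derivN, derivC, derivX).
  rewrite !(hornerD, hornerM, hornerC, hornerN, hornerX) PE P'E /GRing.scale/=.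
  by ring.
- move=> x t.
  have -> : (fun s => e * expR (- K * (x, s).2 + 0) * (rho ^+ 2 - ((x, s).1 - l) ^+ 2) ^+ 2) =
      (fun s => (e * (rho ^+ 2 - (x - l) ^+ 2) ^+ 2) * expR (- K * s + 0)).
    by apply/funext => y /=; ring.
  apply: (is_derive_eq (is_derive_expR_affine _ _ _ _)).
  by rewrite /=; ring.
Qed.

End barriers.

(** * Monotonicity in time *)

Section super_at_operations.
Context {R : realType}.
Variables (sigma r q : R).
Implicit Types (u v : R * R -> R) (z : R * R).

Lemma super_atD u v z : super_at sigma r q u z -> super_at sigma r q v z ->
  super_at sigma r q (fun w => u w + v w) z.
Proof.
move=> [d1 d10 H1] [d2 d20 H2].
exists (Num.min d1 d2) => [|eta eta0]; first by rewrite lt_min d10.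
have eta20 : 0 < eta / 2 by rewrite divr_gt0.
have [U1 [Ux1 [Uxx1 [Ut1 [[c1 dx1 dxx1 dt1] UE1 P1]]]]] := H1 _ eta20.
have [U2 [Ux2 [Uxx2 [Ut2 [[c2 dx2 dxx2 dt2] UE2 P2]]]]] := H2 _ eta20.
have s1 w : cbox z (Num.min d1 d2) w -> cbox z d1 w.
  by apply: cbox_subset; rewrite ge_min lexx.
have s2 w : cbox z (Num.min d1 d2) w -> cbox z d2 w.
  by apply: cbox_subset; rewrite ge_min lexx orbT.
exists (U1 + U2), (Ux1 + Ux2), (Uxx1 + Uxx2), (Ut1 + Ut2); split.
- split.
  + by move=> w; apply: cvgD; [exact: c1|exact: c2].
  + by move=> x t; exact: is_deriveD (dx1 x t) (dx2 x t).
  + by move=> x t; exact: is_deriveD (dxx1 x t) (dxx2 x t).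
  + by move=> x t; exact: is_deriveD (dt1 x t) (dt2 x t).
- move=> w zw; rewrite fctE (_ : _ - _ = (U1 w - u w) + (U2 w - v w)); last by ring.
  rewrite (le_trans (ler_normD _ _))// [leRHS]splitr lerD//.
    exact/UE1/s1.
  exact/UE2/s2.
- move=> w zw; have := P1 _ (s1 _ zw); have := P2 _ (s2 _ zw).
  by rewrite /opL !fctE; lra.
Qed.

Lemma super_at_shift u z (h : R) : super_at sigma r q u (z.1, z.2 + h) ->
  super_at sigma r q (fun w => u (w.1, w.2 + h)) z.
Proof.
move=> [d d0 H]; exists d => // eta eta0.
have [U [Ux [Uxx [Ut [[c dx dxx dt] UE PU]]]]] := H _ eta0.
have s w : cbox z d w -> cbox (z.1, z.2 + h) d (w.1, w.2 + h).
  by move=> [w1 w2]; split=> //=; rewrite opprD addrACA subrr addr0.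
exists (fun w => U (w.1, w.2 + h)), (fun w => Ux (w.1, w.2 + h)),
  (fun w => Uxx (w.1, w.2 + h)), (fun w => Ut (w.1, w.2 + h)); split.
- split.
  + have -> : (fun w : R * R => U (w.1, w.2 + h)) = (fun w => U (w + (0, h))).
      by apply/funext => -[x t]; congr (U (_, _)); rewrite /= addr0.
    move=> w; apply: (@cvg_comp _ _ _ (fun w : R * R => w + (0, h)) U).
      by apply: cvgD; [exact: cvg_id|exact: cvg_cst].
    exact: c.
  + by move=> x t; exact: (dx x (t + h)).
  + by move=> x t; exact: (dxx x (t + h)).
  + move=> x t.
    have d1 : is_derive t 1 (fun s => s + h) 1.
      by apply: is_derive_eq; rewrite addr0.
    have d2 : is_derive t 1 ((fun s => U (x, s)) \o (fun s => s + h)) (Ut (x, t + h) * 1).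
      by apply: is_derive1_comp; exact: dt.
    by apply: is_derive_eq d2 _; rewrite mulr1.
- by move=> w /s/UE.
- by move=> w /s/PU.
Qed.

Lemma within_continuous_cboxP (A : set (R * R)) u : {within A, continuous u} <->
  (forall z, A z -> forall e, 0 < e ->
    exists2 d, 0 < d & forall w, A w -> cbox z d w -> `|u w - u z| <= e).
Proof.
rewrite subspace_continuousP; split=> [H z Az e e0|H z Az].
  have /cvgrPdist_le/(_ e e0) := H z Az.
  rewrite /within/= => /nbhs_cbox[d d0 dA]; exists d => // w Aw /dA/(_ Aw).
  by rewrite distrC.
apply/cvgrPdist_le => e e0; have [d d0 Hd] := H z Az e e0.
apply: filterS (cbox_nbhs z d0) => w zw Aw.
by rewrite distrC; exact: Hd.
Qed.

End super_at_operations.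

Section payoff.
Context {R : realType}.
Variables (K1 k2 K2 : R).
Hypothesis K20 : 0 < K2.
Implicit Types x : R.

(** The branch of [psi2] to the left of ln K2, continued smoothly to the whole line, where it stays
    below [psi2]. *)
Definition payoff x := K2 + k2 - K1 - expR x.

Lemma psi2_in x : x <= ln K2 -> psi2 K1 k2 K2 x = payoff x.
Proof.
move=> xl; rewrite /psi2 /payoff max_l; first by ring.
by rewrite subr_ge0 -(lnK (x := K2)) ?posrE// ler_expR.
Qed.

Lemma psi2_out x : ln K2 <= x -> psi2 K1 k2 K2 x = payoff x + (expR x - K2).
Proof.
move=> xl; rewrite /psi2 /payoff max_r; first by ring.
by rewrite subr_le0 -(lnK (x := K2)) ?posrE// ler_expR.
Qed.

Lemma psi2_ge x : payoff x <= psi2 K1 k2 K2 x.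
Proof.
rewrite /psi2 /payoff; have : K2 - expR x <= Num.max (K2 - expR x) 0.
  by rewrite le_max lexx.
lra.
Qed.

End payoff.

Section monotonicity.
Context {R : realType}.
Variables (K1 k2 K2 sigma r q T : R).
Hypothesis r0 : 0 < r.
Variable Y : R * R -> R.
Implicit Types (x t : R) (z w : R * R).
Let psi := psi2 K1 k2 K2.
Let mu := r - q - sigma ^+ 2 / 2.
Let Q := clQ k2 T.
Hypothesis Yc : {within Q, continuous Y}.
Hypothesis Yb : exists M, forall z, Q z -> `|Y z| <= M.
Hypothesis Yge : forall z, Q z -> psi z.1 <= Y z.
Hypothesis Y0 : forall x, ln k2 <= x -> Y (x, 0) = psi x.
Hypothesis Yl : forall t, 0 <= t <= T -> Y (ln k2, t) = K2 - K1.
Hypothesis Ysup : forall z, openQ k2 T z -> super_at sigma r q Y z.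
Hypothesis Ysub : forall z, openQ k2 T z -> psi z.1 < Y z ->
  super_at sigma r q (fun w => - Y w) z.

Let QE x t : ln k2 <= x -> 0 <= t -> t <= T -> Q (x, t).
Proof. by move=> *; split=> //=; apply/andP. Qed.

Let Ycont z : Q z -> forall e, 0 < e ->
  exists2 d, 0 < d & forall w, Q w -> cbox z d w -> `|Y w - Y z| <= e.
Proof. by move/within_continuous_cboxP: Yc; exact. Qed.

Tactic Notation "lra_from" hyp_list(hs) :=
  revert hs; clear - R K1 k2 K2 sigma r q T r0 Y psi mu Q Yc Yb Yge Y0 Yl Ysup Ysub QE Ycont;
  intros; lra.

Lemma shift_within (h a b s t : R) : ln k2 <= a -> 0 <= s -> 0 <= h -> t + h <= T ->
  {within [set w : R * R | a <= w.1 <= b /\ s <= w.2 <= t],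
    continuous (fun w => Y (w.1, w.2 + h) + - Y w)}.
Proof.
move=> la s0 h0 th; apply/within_continuous_cboxP.
move=> z [/andP[az zb] /andP[sz zt]] e e0.
have e20 : 0 < e / 2 by rewrite divr_gt0.
have Q1 (w : R * R) : a <= w.1 <= b /\ s <= w.2 <= t -> Q (w.1, w.2 + h).
  by move=> [/andP[w1 _] /andP[w2 w3]]; apply: QE; lra_from la s0 h0 th w1 w2 w3.
have Q2 (w : R * R) : a <= w.1 <= b /\ s <= w.2 <= t -> Q w.
  by case: w => y u [/andP[/= w1 _] /andP[/= w2 w3]]; apply: QE; lra_from la s0 h0 th w1 w2 w3.
have zA : a <= z.1 <= b /\ s <= z.2 <= t by rewrite az zb sz zt.
have [d1 d10 H1] := Ycont (Q1 _ zA) e20.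
have [d2 d20 H2] := Ycont (Q2 _ zA) e20.
exists (Num.min d1 d2); first by rewrite lt_min d10.
move=> w wA zw.
have B1 : cbox (z.1, z.2 + h) d1 (w.1, w.2 + h).
  have := cbox_subset (_ : Num.min d1 d2 <= d1) zw; rewrite ge_min lexx => /(_ erefl).
  by move=> [? ?]; split=> //=; rewrite opprD addrACA subrr addr0.
have B2 : cbox z d2 w.
  by apply: (cbox_subset _ zw); rewrite ge_min lexx orbT.
rewrite (_ : _ - _ = (Y (w.1, w.2 + h) - Y (z.1, z.2 + h)) - (Y w - Y z)); last by ring.
rewrite (le_trans (ler_normB _ _))// [leRHS]splitr lerD//.
- by apply: H1 => //; exact: Q1.
- by apply: H2 => //; exact: Q2.
Qed.

(** The half-line is unbounded, so a quadratic weight with a small factor [th] controls infinity.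
    Where Y(., . + h) - Y is below the negative barrier, Y > Y(., . + h) >= psi2, so [-Y] is a
    supersolution there. *)
Lemma Y_shift_ge x t (h th : R) : ln k2 <= x -> 0 <= t -> 0 <= h -> t + h < T -> 0 < th ->
  Y (x, t) - Y (x, t + h) <=
    th * (1 + (x - ln k2) ^+ 2 + (sigma ^+ 2 + mu ^+ 2 / r) * t).
Proof.
move=> xl t0 h0 thT th0; have [M HM] := Yb.
(* sigma^2 comes from the second derivative of the weight, mu^2 / r is the maximum of 2 mu y - r
   y^2. *)
set A := sigma ^+ 2 + mu ^+ 2 / r.
have A0 : 0 <= A by rewrite addr_ge0 ?sqr_ge0// divr_ge0 ?sqr_ge0// ltW.
have M0 : 0 <= M.
  by apply: le_trans (HM (x, t) _); [exact: normr_ge0|apply: QE; lra].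
(* Chosen so that th D^2 >= 2 M: on the side X = x + D the bound on Y suffices. *)
pose D := 1 + 2 * M / th.
have Mth0 : 0 <= 2 * M / th by rewrite divr_ge0 ?mulr_ge0// ltW.
have thD : 2 * M <= th * D ^+ 2.
  have E : th * D = th + 2 * M by rewrite /D; field; rewrite gt_eqF.
  have : th * D * 1 <= th * D * D.
    apply: ler_wpM2l; first by rewrite E; lra.
    by rewrite /D; lra.
  by rewrite mulr1 -mulrA -expr2; lra.
pose X := x + D.
have bx : ln k2 <= x <= X by rewrite xl/= /X /D; lra.
have thr0 : 0 < th * r by rewrite mulr_gt0.
have cS := @shift_within h (ln k2) X 0 t (lexx _) (lexx _) h0 (ltW thT).
have H := @super_comparison _ sigma r q r0 _ _ _ _ _ _ _ _ _ _ thr0 cS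
  (C21_quadratic_exp (- th) 0 (- th) (ln k2) 0 (- th * A)).
have : - th + 0 * (x - ln k2) + - th * (x - ln k2) ^+ 2 + 0 * expR x +
    - th * A * t <= Y (x, t + h) + - Y (x, t).
  apply: (H _ _ _ (x, t)) => /=; last by rewrite bx t0 lexx.
  - move=> -[y s]/= [/andP[ly yX] /andP[s0 st]]; rewrite /opL/= -/mu.
    have H1 : th * (2 * mu * (y - ln k2) - r * (y - ln k2) ^+ 2 - mu ^+ 2 / r) <= 0.
      have -> : 2 * mu * (y - ln k2) - r * (y - ln k2) ^+ 2 - mu ^+ 2 / r =
        - ((r * (y - ln k2) - mu) ^+ 2 / r) by field; rewrite gt_eqF.
      by rewrite mulrN oppr_le0 mulr_ge0 ?(ltW th0)// divr_ge0 ?sqr_ge0// ltW.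
    have H2 : 0 <= r * (th * (A * s)).
      by rewrite !mulr_ge0// ltW.
    rewrite /A in H2 *; lra.
  - move=> -[y s]/= [/andP[ly yX] /andP[s0 st]].
    have H2 : 0 <= th * (A * s) by rewrite !mulr_ge0// ltW.
    have H3 : 0 <= th * (y - ln k2) ^+ 2 by rewrite mulr_ge0 ?sqr_ge0// ltW.
    case=> [E|E|E].
    + rewrite E !Yl; last 2 first.
        by apply/andP; split; lra_from s0 st h0 thT.
        by apply/andP; split; lra_from s0 st h0 thT.
      by rewrite -E; lra_from H2 H3 th0.
    + have Q1 : Q (y, s + h) by apply: QE; lra_from ly s0 st h0 thT.
      have Q2 : Q (y, s) by apply: QE; lra_from ly s0 st h0 thT.
      have := HM _ Q1; have := HM _ Q2.
      rewrite !ler_norml => /andP[? ?] /andP[? ?].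
      have : th * D ^+ 2 <= th * (y - ln k2) ^+ 2.
        have D0 : 0 <= D by rewrite /D; lra.
        rewrite ler_pM2l// ler_sqr ?nnegrE//; first by rewrite E /X; lra.
        by rewrite subr_ge0.
      lra.
    + have Q1 : Q (y, s + h) by apply: QE; lra_from ly s0 st h0 thT.
      have YE : Y (y, s) = psi y by rewrite E Y0.
      have := Yge Q1; rewrite /= YE => Yp; lra_from Yp H2 H3 th0.
  - move=> -[y s]/= /andP[ly yX] /andP[s0 st] lt.
    have H2 : 0 <= th * (A * s) by rewrite !mulr_ge0// ltW.
    have H3 : 0 <= th * (y - ln k2) ^+ 2 by rewrite mulr_ge0 ?sqr_ge0// ltW.
    have o1 : openQ k2 T (y, s + h).
      by split=> //=; apply/andP; split; lra_from s0 st h0 thT.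
    have o2 : openQ k2 T (y, s) by split=> //=; apply/andP; split; lra_from s0 st h0 thT.
    have Q1 : Q (y, s + h) by apply: QE; lra_from ly s0 st h0 thT.
    have Yp := Yge Q1.
    apply: super_atD; first by apply: super_at_shift; exact: Ysup.
    by apply: Ysub => //=; rewrite /= in Yp; lra_from Yp lt H2 H3 th0.
rewrite /A; lra.
Qed.

Lemma Y_nondecreasing x s t : ln k2 <= x -> 0 <= s -> s <= t -> t <= T ->
  Y (x, s) <= Y (x, t).
Proof.
move=> xl s0 st tT.
have main t' : s <= t' -> t' < T -> Y (x, s) <= Y (x, t').
  move=> st' t'T; apply/ler_addgt0Pr => e e0.
  pose A := 1 + (x - ln k2) ^+ 2 + (sigma ^+ 2 + mu ^+ 2 / r) * s.
  have A0 : 0 < A.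
    have : 0 <= (sigma ^+ 2 + mu ^+ 2 / r) * s.
      by rewrite mulr_ge0// addr_ge0 ?sqr_ge0// divr_ge0 ?sqr_ge0// ltW.
    by rewrite /A; have := sqr_ge0 (x - ln k2); lra.
  have := @Y_shift_ge x s (t' - s) (e / A) xl s0; rewrite subr_ge0 => /(_ st').
  rewrite addrC subrK divr_gt0// => /(_ t'T erefl).
  by rewrite -/A divfK ?gt_eqF//; lra.
(* The comparison covers t < T; time T is reached by continuity. *)
have [tT'|tT'] := ltP t T; first exact: main.
have sT' := le_trans st tT.
have {tT tT'} -> : t = T by apply/eqP; rewrite eq_le tT tT'.
have [sT|sT] := ltP s T; last by have -> // : s = T by apply/eqP; rewrite eq_le sT sT'.
apply/ler_addgt0Pr => e e0.
have QT : Q (x, T) by apply: QE; lra.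
have [d d0 Hd] := Ycont QT e0.
pose t' := Num.max s (T - d).
have st' : s <= t' by rewrite /t' le_max lexx.
have t'T : t' < T by rewrite /t' gt_max sT/=; lra.
have dt' : T - d <= t' by rewrite /t' le_max lexx orbT.
have Qt' : Q (x, t') by apply: QE; lra.
have := Hd _ Qt'; rewrite ler_norml => H; have /H/andP[_ H1] : cbox (x, T) d (x, t').
  split => /=; first by rewrite subrr normr0 ltW.
  by rewrite ler_distl; apply/andP; split; lra.
by have := main _ st' t'T; lra.
Qed.

End monotonicity.

(** * The contact set *)

Section free_boundary.
Context {R : realType}.
Variables (K1 k2 K2 sigma r q T : R).
Hypotheses (k20 : 0 < k2) (k2K2 : k2 < K2)
  (sigma0 : 0 < sigma) (r0 : 0 < r) (q0 : 0 <= q).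
Variable Y : R * R -> R.
Implicit Types (x t : R) (z w : R * R).
Let psi := psi2 K1 k2 K2.
Let C := K2 + k2 - K1.
Let G := payoff K1 k2 K2.
Let mu := r - q - sigma ^+ 2 / 2.
Let Q := clQ k2 T.
Hypothesis Yc : {within Q, continuous Y}.
Hypothesis Yge : forall z, Q z -> psi z.1 <= Y z.
Hypothesis Y0 : forall x, ln k2 <= x -> Y (x, 0) = psi x.
Hypothesis Yl : forall t, 0 <= t <= T -> Y (ln k2, t) = K2 - K1.
Hypothesis Ysup : forall z, openQ k2 T z -> super_at sigma r q Y z.
Hypothesis Ysub : forall z, openQ k2 T z -> psi z.1 < Y z ->
  super_at sigma r q (fun w => - Y w) z.
Hypothesis Ynd : forall x s t, ln k2 <= x -> 0 <= s -> s <= t -> t <= T ->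
  Y (x, s) <= Y (x, t).

Let K20 : 0 < K2. Proof. exact: lt_trans k2K2. Qed.

Let lnk2K2 : ln k2 < ln K2. Proof. by rewrite ltr_ln ?posrE. Qed.

Let QE x t : ln k2 <= x -> 0 <= t -> t <= T -> Q (x, t).
Proof. by move=> *; split=> //=; apply/andP. Qed.

Let Ycont z : Q z -> forall e, 0 < e ->
  exists2 d, 0 < d & forall w, Q w -> cbox z d w -> `|Y w - Y z| <= e.
Proof. by move/within_continuous_cboxP: Yc; exact. Qed.

Let YG z : Q z -> G z.1 <= Y z.
Proof. by move=> /Yge; apply: le_trans; exact: psi2_ge. Qed.

Let Glnk2 : G (ln k2) = K2 - K1.
Proof. by rewrite /G /payoff lnK ?posrE//; ring. Qed.

Tactic Notation "lra_from" hyp_list(hs) :=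
  revert hs; move: lnk2K2; clear - R K1 k2 K2 sigma r q T k20 k2K2 sigma0 r0 q0 Y psi C G mu Q
    Yc Yge Y0 Yl Ysup Ysub Ynd K20 lnk2K2 QE Ycont YG Glnk2;
  intros; lra.

(** Since -LG = r C - q e^x, a violation would make G a strict subsolution near x. *)
Lemma contact_le x t : ln k2 < x -> 0 < t -> t <= T -> Y (x, t) = G x ->
  q * expR x <= r * C.
Proof.
move=> lx t0 tT YGx; rewrite leNgt; apply/negP => qC.
(* [t] may be T; by monotonicity the contact already holds at t / 2, inside the open domain. *)
pose s := t / 2.
have s0 : 0 < s by rewrite divr_gt0.
have st : s < t by rewrite /s; lra.
have xQ : openQ k2 T (x, s) by split=> //=; rewrite s0/= (lt_le_trans st).
have Ys : Y (x, s) = G x.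
  apply/eqP; rewrite eq_le -{1}YGx Ynd//=; [|lra..].
  by apply: (YG (z := (x, s))); apply: QE; lra.
pose g := q * expR x - r * C.
have g0 : 0 < g by rewrite subr_gt0.
have [d1 d10 [d1Q _]] := openQ_cbox K2 xQ.
have [d2 d20 Hd2] : exists2 d2, 0 < d2 &
    forall y : R, `|y - x| <= d2 -> q * expR x - q * expR y <= g / 2.
  have cq : q * expR y @[y --> x] --> q * expR x.
    by apply: cvgM; [exact: cvg_cst|exact: continuous_expR].
  have g20 : 0 < g / 2 by rewrite divr_gt0.
  move/cvgrPdist_le: cq => /(_ _ g20)/nbhs_ballP[d2 /= d20 Hd].
  exists (d2 / 2); first by rewrite divr_gt0.
  move=> y yx; apply: le_trans (ler_norm _) _; apply: Hd.
  by rewrite /ball/= distrC; lra.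
pose d := Num.min d1 d2.
have d0 : 0 < d by rewrite lt_min d10.
have dd1 : d <= d1 by rewrite /d ge_min lexx.
have dd2 : d <= d2 by rewrite /d ge_min lexx orbT.
have g20 : 0 < g / 2 by rewrite divr_gt0.
apply: (super_touch (m := 0) r0 g20 d0 (Ysup xQ)
  (C21_quadratic_exp C 0 0 0 (-1) 0)).
- move=> w zw wt; rewrite subr_ge0.
  have -> : C + 0 * (w.1 - 0) + 0 * (w.1 - 0) ^+ 2 + -1 * expR w.1 + 0 * w.2 = G w.1.
    by rewrite /G /payoff /C; ring.
  by apply: YG; exact/openQ_subset_clQ/d1Q/(cbox_subset dd1).
- by rewrite Ys /G /payoff /C /=; ring.
- move=> w zw wt; rewrite /opL/=.
  have := Hd2 w.1 (le_trans zw.1 dd2); rewrite /g; lra.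
Qed.

(* G + c/2 (x - x0) + M (x - x0)^2 touches Y from below at (x0, t0) and is a
   strict subsolution for M large. *)
Lemma no_kink x0 t0 (c d : R) : openQ k2 T (x0, t0) -> 0 < c -> 0 < d ->
  Y (x0, t0) = G x0 ->
  (forall w, Q w -> cbox (x0, t0) d w -> w.2 <= t0 ->
    G w.1 + c * (w.1 - x0) <= Y w) -> False.
Proof.
move=> zQ c0 d0 YGx kink.
have [d1 d10 [d1Q _]] := openQ_cbox K2 zQ.
have s20 : 0 < sigma ^+ 2 by rewrite exprn_gt0.
(* Bounds the zero- and first-order terms, plus a margin 1; sigma^2 M = N makes the second-order
   term absorb them. *)
pose N := r * `|C| + 2 * c * `|mu| + r * c + 1.
have N0 : 0 < N.
  have := mulr_ge0 (ltW r0) (normr_ge0 C).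
  have := mulr_ge0 (ltW c0) (normr_ge0 mu).
  have := mulr_gt0 r0 c0; rewrite /N; lra.
pose M := N / sigma ^+ 2.
have M0 : 0 < M by rewrite divr_gt0.
have MN : sigma ^+ 2 * M = N by rewrite /M mulrC divfK// gt_eqF.
(* With M e <= c / 2 the slope c / 2 + M (x - x0) stays between 0 and c: the parabola is below the
   kink on the right and below G on the left. *)
pose e := Num.min (Num.min d d1) (Num.min (c / (2 * M)) 1).
have e0 : 0 < e by rewrite !lt_min d0 d10 ltr01 divr_gt0// mulr_gt0.
have [ed ed1 eM e1] : [/\ e <= d, e <= d1, e <= c / (2 * M) & e <= 1].
  by split; rewrite /e !ge_min lexx ?orbT.
have {}eM : 2 * M * e <= c.
  have M20 : 0 < 2 * M by rewrite mulr_gt0.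
  by rewrite mulrC -ler_pdivlMr.
apply: (super_touch (m := 0) r0 ltr01 e0 (Ysup zQ)
  (C21_quadratic_exp C (c / 2) M x0 (-1) 0)).
- move=> w zw wt; rewrite subr_ge0.
  have Qw : Q w by exact/openQ_subset_clQ/d1Q/(cbox_subset ed1).
  have -> : C + c / 2 * (w.1 - x0) + M * (w.1 - x0) ^+ 2 + -1 * expR w.1 + 0 * w.2 =
      G w.1 + (c / 2 + M * (w.1 - x0)) * (w.1 - x0).
    by rewrite /G /payoff /C; ring.
  have : `|M * (w.1 - x0)| <= c / 2.
    rewrite normrM gtr0_norm//.
    have : M * `|w.1 - x0| <= M * e by rewrite ler_pM2l//; case: zw.
    lra.
  rewrite ler_norml => /andP[H1 H2].
  have [y0|y0] := leP 0 (w.1 - x0).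
    apply: le_trans (kink _ Qw (cbox_subset ed zw) wt); rewrite lerD2l.
    by rewrite ler_wpM2r//; lra.
  apply: le_trans (YG Qw); rewrite gerDl nmulr_lle0//; lra.
- by rewrite YGx /G /payoff /C /= subrr expr0n/=; ring.
- move=> w [/= w1 _] wt; rewrite /opL/= -/mu.
  set y := w.1 - x0 in w1 *.
  have y1 : `|y| <= 1 by apply: le_trans w1 e1.
  have My : `|M * y| <= c / 2.
    rewrite normrM gtr0_norm//.
    have : M * `|y| <= M * e by rewrite ler_pM2l.
    lra.
  have H1 : - (mu * (c / 2 + 2 * M * y)) <= 2 * c * `|mu|.
    rewrite -mulrN (le_trans (ler_norm _))// normrM mulrC ler_wpM2r// normrN.
    rewrite (le_trans (ler_normD _ _))// gtr0_norm ?divr_gt0//.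
    by rewrite -mulrA normrM ger0_norm//; lra.
  have H2 : r * (c / 2 * y + M * y ^+ 2) <= r * c.
    rewrite ler_pM2l//.
    have : `|c / 2 * y| <= c / 2.
      by rewrite normrM gtr0_norm ?divr_gt0// ler_piMr// divr_ge0// ltW.
    have : `|M * y * y| <= c / 2.
      by rewrite normrM (le_trans _ My)// ler_piMr.
    rewrite !ler_norml expr2 mulrA => /andP[_ ?] /andP[_ ?]; lra.
  have H3 : r * C <= r * `|C| by rewrite ler_pM2l// ler_norm.
  have H4 : 0 <= q * expR w.1 by rewrite mulr_ge0// expR_ge0.
  rewrite /N in MN.
  have Ee : mu * expR w.1 = (r - q) * expR w.1 - sigma ^+ 2 / 2 * expR w.1.
    by rewrite /mu; ring.
  lra.
Qed.

(** psi2 itself has a convex kink at ln K2: to the right, psi2 - G = e^x - K2 >= K2 (x - ln K2). *)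
Lemma contact_lt_lnK2 t : 0 < t -> t <= T -> G (ln K2) < Y (ln K2, t).
Proof.
move=> t0 tT; have lK := lnk2K2.
have Qt : Q (ln K2, t / 2) by apply: QE; lra.
have zQ : openQ k2 T (ln K2, t / 2).
  by split=> //=; apply/andP; split; lra.
have YtT : Y (ln K2, t / 2) <= Y (ln K2, t) by apply: Ynd; lra.
apply: lt_le_trans YtT.
have YGt : G (ln K2) <= Y (ln K2, t / 2) := YG Qt.
rewrite lt_neqAle YGt andbT; apply/eqP => /esym YGl.
apply: (no_kink zQ K20 ltr01 YGl) => w Qw _ _.
apply: le_trans (Yge Qw); have [wl|/ltW wl] := leP w.1 (ln K2).
  rewrite /psi psi2_in// gerDl mulr_ge0_le0 ?(ltW K20)//; lra.
rewrite /psi psi2_out// lerD2l.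
have := expR_ge1Dx (w.1 - ln K2); rewrite expRD expRN lnK ?posrE//.
rewrite ler_pdivlMr//; lra.
Qed.

Lemma within_oppY (a b s t : R) : ln k2 <= a -> 0 <= s -> t <= T ->
  {within [set w : R * R | a <= w.1 <= b /\ s <= w.2 <= t], continuous (fun w => - Y w)}.
Proof.
move=> la s0 tT; apply/within_continuous_cboxP => z zA e e0.
have sub (w : R * R) : a <= w.1 <= b /\ s <= w.2 <= t -> Q w.
  by case: w => y u [/andP[/= ? ?] /andP[/= ? ?]]; apply: QE; lra.
have [d d0 Hd] := Ycont (sub _ zA) e0; exists d => // w wA zw.
by rewrite -opprD normrN; apply: Hd => //; exact: sub.
Qed.

Lemma contact_persists x0 t0 (d : R) : 0 < d -> ln k2 <= x0 - d -> x0 + d <= ln K2 ->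
  0 <= t0 -> t0 < T -> q * expR (x0 + d) < r * C ->
  (forall y : R, `|y - x0| <= d -> Y (y, t0) = G y) ->
  exists2 e, 0 < e & forall t, t0 <= t -> t <= t0 + e -> t < T -> Y (x0, t) = G x0.
Proof.
move=> d0 lx xl t00 t0T qC contact.
pose g := r * C - q * expR (x0 + d).
have g0 : 0 < g by rewrite subr_gt0.
have s20 : 0 < sigma ^+ 2 by rewrite exprn_gt0.
(* Adding c (x - x0)^2 lowers the margin [g] of G by at most c A = g / 2. *)
pose A := sigma ^+ 2 + 2 * (`|mu| * d).
have A0 : 0 < A by rewrite ltr_wpDr// mulr_ge0// mulr_ge0// ltW.
pose c := g / (2 * A).
have c0 : 0 < c by rewrite divr_gt0// mulr_gt0.
have cA : c * A = g / 2 by rewrite /c; field; rewrite gt_eqF.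
have cd0 : 0 < c * d ^+ 2 by rewrite mulr_gt0// exprn_gt0.
have Q1 : Q (x0 - d, t0) by apply: QE; lra_from d0 lx xl t00 t0T.
have Q2 : Q (x0 + d, t0) by apply: QE; lra_from d0 lx xl t00 t0T.
(* On the sides x0 - d and x0 + d the barrier exceeds G by c d^2; continuity of Y keeps it above Y
   there for a short time. *)
have [e1 e10 H1] := Ycont Q1 cd0.
have [e2 e20 H2] := Ycont Q2 cd0.
have C1 : Y (x0 - d, t0) = G (x0 - d).
  by apply: contact; rewrite (_ : _ - x0 = - d); [rewrite normrN gtr0_norm|ring].
have C2 : Y (x0 + d, t0) = G (x0 + d).
  by apply: contact; rewrite (_ : _ - x0 = d); [rewrite gtr0_norm|ring].
exists (Num.min e1 e2) => [|t tt0 te tT]; first by rewrite lt_min e10.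
have [te1 te2] : t <= t0 + e1 /\ t <= t0 + e2.
  by split; apply: le_trans te _; rewrite lerD2l ge_min lexx ?orbT.
have g20 : 0 < g / 2 by rewrite divr_gt0.
have cY := @within_oppY (x0 - d) (x0 + d) t0 t lx t00 (ltW tT).
have H := @super_comparison _ sigma r q r0 _ _ _ _ _ _ _ _ _ _ g20 cY
  (C21_quadratic_exp (- C) 0 (- c) x0 1 0).
have phiE (w : R * R) : - C + 0 * (w.1 - x0) + - c * (w.1 - x0) ^+ 2 + 1 * expR w.1 + 0 * w.2 =
    - (G w.1 + c * (w.1 - x0) ^+ 2) by rewrite /G /payoff -/C; ring.
have cy (x : R) : 0 <= c * (x - x0) ^+ 2 by rewrite mulr_ge0 ?sqr_ge0// ltW.
have : - (G (x0, t).1 + c * ((x0, t).1 - x0) ^+ 2) <= - Y (x0, t).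
  rewrite -phiE; apply: (H _ _ _ (x0, t)) => /=.
  - move=> w [/andP[w1 w2] _]; rewrite /opL/= -/mu.
    have h1 : q * expR w.1 <= q * expR (x0 + d) by rewrite ler_wpM2l// ler_expR.
    have h2 : c * (mu * (w.1 - x0)) <= c * (`|mu| * d).
      rewrite ler_pM2l// (le_trans (ler_norm _))// normrM ler_wpM2l//.
      by rewrite ler_distl w1.
    have h3 : 0 <= r * (c * (w.1 - x0) ^+ 2) by rewrite mulr_ge0// ltW.
    have h4 : mu * expR w.1 = (r - q) * expR w.1 - sigma ^+ 2 / 2 * expR w.1.
      by rewrite /mu; ring.
    have h5 : c * sigma ^+ 2 + 2 * (c * (`|mu| * d)) = g / 2.
      by rewrite -cA /A; ring.
    rewrite /g in h5 *; lra_from h1 h2 h3 h4 h5.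
  - move=> [y u] [/andP[/= w1 w2] /andP[/= w3 w4]]; rewrite (phiE (y, u))/= lerN2.
    have Qw : Q (y, u) by apply: QE; lra_from lx w1 t00 w3 w4 tT.
    case=> [E|E|E].
    + have : cbox (x0 - d, t0) e1 (y, u).
        by split; rewrite /= ?E ?subrr ?normr0 ?(ltW e10)// ler_distl; apply/andP; split;
          lra_from w3 w4 te1 e10.
      move=> /(H1 _ Qw); rewrite C1 -E ler_norml => /andP[_ h].
      have -> : (y - x0) ^+ 2 = d ^+ 2 by rewrite E; ring.
      lra_from h.
    + have : cbox (x0 + d, t0) e2 (y, u).
        by split; rewrite /= ?E ?subrr ?normr0 ?(ltW e20)// ler_distl; apply/andP; split;
          lra_from w3 w4 te2 e20.
      move=> /(H2 _ Qw); rewrite C2 -E ler_norml => /andP[_ h].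
      have -> : (y - x0) ^+ 2 = d ^+ 2 by rewrite E; ring.
      lra_from h.
    + have Yy : Y (y, t0) = G y.
        by apply: contact; rewrite ler_distl w1.
      by rewrite E Yy lerDl.
  - move=> [y u]/= /andP[w1 w2] /andP[w3 w4]; rewrite (phiE (y, u))/= ltrN2 => lt.
    have o : openQ k2 T (y, u).
      by split=> //=; [|apply/andP; split]; lra_from lx w1 t00 w3 w4 tT.
    apply: Ysub => //=; rewrite /psi psi2_in//; last by lra_from w2 xl.
    by apply: le_lt_trans lt; rewrite lerDl.
  - by split; apply/andP; split; lra_from d0 tt0.
rewrite /= subrr expr0n/= mulr0 addr0 lerN2 => YleG.
have Qx : Q (x0, t) by apply: QE; lra_from d0 lx t00 tt0 tT.
by apply/eqP; rewrite eq_le YleG; exact: (YG Qx).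
Qed.

(** On [ln k2, x2] x [0, t0] Y is compared with G + e, a strict supersolution with margin r e. On
    the right side, contact at [t0] forces contact at all earlier times by monotonicity. *)
Lemma contact_connected x2 t0 x : ln k2 < x2 -> x2 <= ln K2 -> 0 <= t0 -> t0 < T ->
  q * expR x2 <= r * C -> Y (x2, t0) = G x2 -> ln k2 <= x -> x <= x2 ->
  Y (x, t0) = G x.
Proof.
move=> lx2 x2l t00 t0T qC YGx2 lx xx2.
have Qx : Q (x, t0) by apply: QE; lra_from lx t00 t0T.
apply/eqP; rewrite eq_le; apply/andP; split; last exact: (YG Qx).
apply/ler_addgt0Pr => e e0.
have cY := @within_oppY (ln k2) x2 0 t0 (lexx _) (lexx _) (ltW t0T).
have re0 : 0 < r * e by rewrite mulr_gt0.
have H := @super_comparison _ sigma r q r0 _ _ _ _ _ _ _ _ _ _ re0 cY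
  (C21_quadratic_exp (- (C + e)) 0 0 0 1 0).
have phiE (w : R * R) : - (C + e) + 0 * (w.1 - 0) + 0 * (w.1 - 0) ^+ 2 + 1 * expR w.1 + 0 * w.2 =
    - (G w.1 + e) by rewrite /G /payoff -/C; ring.
have : - (G (x, t0).1 + e) <= - Y (x, t0); last by rewrite lerN2.
rewrite -phiE; apply: (H _ _ _ (x, t0)) => /=.
- move=> w [/andP[w1 w2] _]; rewrite /opL/= -/mu.
  have h1 : q * expR w.1 <= q * expR x2 by rewrite ler_wpM2l// ler_expR.
  have h4 : mu * expR w.1 = (r - q) * expR w.1 - sigma ^+ 2 / 2 * expR w.1.
    by rewrite /mu; ring.
  lra.
- move=> [y u] [/andP[/= w1 w2] /andP[/= w3 w4]]; rewrite (phiE (y, u))/= lerN2.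
  case=> [E|E|E].
  + by rewrite E Yl ?Glnk2; [lra_from e0|apply/andP; split; lra_from w3 w4 t0T].
  + have : Y (x2, u) <= Y (x2, t0) by apply: Ynd; lra_from lx2 w3 w4 t0T.
    by rewrite YGx2 E => h; lra_from h e0.
  + by rewrite E Y0// /psi psi2_in; [rewrite -/G; lra_from e0|exact: K20|lra_from w2 x2l].
- move=> [y u]/= /andP[w1 w2] /andP[w3 w4]; rewrite (phiE (y, u))/= ltrN2 => lt.
  have o : openQ k2 T (y, u) by split=> //=; apply/andP; split; lra_from w3 w4 t0T.
  apply: Ysub => //=; rewrite /psi psi2_in//; last by lra_from w2 x2l.
  by rewrite -/G; lra_from lt e0.
- by split; apply/andP; split; lra_from lx xx2 t00.
Qed.

Let monotone_shift_ge0 (h x u : R) : ln k2 <= x -> 0 <= u -> 0 <= h -> u + h <= T ->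
  0 <= Y (x, u + h) + - Y (x, u).
Proof. by move=> lx u0 h0 uhT; rewrite subr_ge0; apply: Ynd => //; lra. Qed.

Let super_shift (h x u : R) : ln k2 < x -> 0 < u -> 0 <= h -> u + h < T ->
  psi x < Y (x, u) -> super_at sigma r q (fun w => Y (w.1, w.2 + h) + - Y w) (x, u).
Proof.
move=> lx u0 h0 uhT psiY; apply: super_atD.
  by apply: super_at_shift; apply: Ysup; split=> //=; apply/andP; split; lra.
by apply: Ysub => //; split=> //=; apply/andP; split; lra.
Qed.

(** Provides the bottom of the tube: as t0 tends to 0, Y(ln K2, t0) tends to G(ln K2) while Y(ln K2,
    t0 + h) >= Y(ln K2, h) > G(ln K2). *)
Lemma near_lnK2 (h s : R) : 0 < h -> h <= T -> 0 < s -> s + h <= T ->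
  exists t0 rho a : R, [/\ 0 < t0 < s, 0 < rho <= (ln K2 - ln k2) / 2, 0 < a &
    forall x : R, `|x - ln K2| <= rho ->
      a <= Y (x, t0 + h) + - Y (x, t0) /\ psi x < Y (x, t0)].
Proof.
move=> h0 hT s0 shT; have lK := lnk2K2.
have psil : psi (ln K2) = G (ln K2) by rewrite /psi psi2_in.
have gt u : 0 < u -> u <= T -> G (ln K2) < Y (ln K2, u) by exact: contact_lt_lnK2.
pose g := Y (ln K2, h) - G (ln K2).
have g0 : 0 < g by rewrite subr_gt0 gt.
have g30 : 0 < g / 3 by rewrite divr_gt0.
have Q0 : Q (ln K2, 0) by apply: QE; lra_from h0 hT.
have [d1 d10 H1] := Ycont Q0 g30.
pose t0 := Num.min d1 s / 2.
have m0 : 0 < Num.min d1 s by rewrite lt_min d10.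
have t00 : 0 < t0 by rewrite divr_gt0.
have t0m : t0 < Num.min d1 s by rewrite /t0 ltr_pdivrMr// ltr_pMr// ltr1n.
have [t0d t0s] : t0 < d1 /\ t0 < s by apply/andP; rewrite -lt_min.
have Qt0 : Q (ln K2, t0) by apply: QE; lra_from t00 t0s h0 shT.
have Qt0h : Q (ln K2, t0 + h) by apply: QE; lra_from t00 t0s h0 shT.
have Yt0 : Y (ln K2, t0) <= G (ln K2) + g / 3.
  have : cbox (ln K2, 0) d1 (ln K2, t0).
    by split; rewrite /= ?subrr ?normr0 ?subr0 ?gtr0_norm// ltW.
  move=> /(H1 _ Qt0); rewrite Y0 ?(ltW lK)// psil ler_norml => /andP[_ le]; lra_from le.
have Yth : Y (ln K2, h) <= Y (ln K2, t0 + h) by apply: Ynd; lra_from t00 t0s h0 shT.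
pose b0 := Y (ln K2, t0) - G (ln K2).
have b00 : 0 < b0 by rewrite subr_gt0 gt// ltW// (lt_trans t0s)//; lra_from h0 shT.
(* The choice of [t0] leaves 2 g / 3 at ln K2, and two errors of g / 6 leave g / 3 nearby. Errors of
   b0 / 3 in Y and in psi2 keep Y > psi2. *)
pose e := Num.min (g / 6) (b0 / 3).
have e0 : 0 < e by rewrite lt_min !divr_gt0.
have [eg eb] : e <= g / 6 /\ e <= b0 / 3 by split; rewrite /e ge_min lexx ?orbT.
have [d2 d20 H2] := Ycont Qt0 e0.
have [d3 d30 H3] := Ycont Qt0h e0.
have [d4 d40 H4] : exists2 d, 0 < d & forall x : R, `|x - ln K2| <= d ->
    psi x <= psi (ln K2) + b0 / 3.
  have b30 : 0 < b0 / 3 by rewrite divr_gt0.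
  have /cvgrPdist_le/(_ _ b30)/nbhs_ballP[d /= d0 Hd] := @psi2_continuous _ K1 k2 K2 (ln K2).
  exists (d / 2) => [|x xd]; first by rewrite divr_gt0.
  have : ball (ln K2) d x by rewrite /ball/= distrC; lra_from d0 xd.
  by move=> /Hd; rewrite ler_norml -/psi => /andP[le _]; lra_from le.
pose rho := Num.min (Num.min d2 d3) (Num.min d4 ((ln K2 - ln k2) / 2)).
have rho0 : 0 < rho by rewrite !lt_min d20 d30 d40/= divr_gt0// subr_gt0.
have [r2 r3 r4 r5] : [/\ rho <= d2, rho <= d3, rho <= d4 & rho <= (ln K2 - ln k2) / 2].
  by split; rewrite /rho !ge_min lexx ?orbT.
exists t0, rho, (g / 3); split; [by rewrite t00|by rewrite rho0|exact: g30|].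
move=> x xr; have /andP[xr1 xr2] : ln K2 - rho <= x <= ln K2 + rho by rewrite -ler_distl.
have Qx : Q (x, t0) by apply: QE; lra_from xr1 r5 t00 t0s h0 shT.
have Qxh : Q (x, t0 + h) by apply: QE; lra_from xr1 r5 t00 t0s h0 shT.
have B2 : cbox (ln K2, t0) d2 (x, t0).
  by split; rewrite /= ?subrr ?normr0 ?(ltW d20)// (le_trans xr).
have B3 : cbox (ln K2, t0 + h) d3 (x, t0 + h).
  by split; rewrite /= ?subrr ?normr0 ?(ltW d30)// (le_trans xr).
have := H2 _ Qx B2; have := H3 _ Qxh B3; have := H4 _ (le_trans xr r4).
rewrite psil !ler_norml => h4 /andP[h3 _] /andP[h2 h2'].
have gE : g = Y (ln K2, h) - G (ln K2) by [].
have bE : b0 = Y (ln K2, t0) - G (ln K2) by [].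
by split; lra_from Yt0 Yth h2 h2' h3 h4 eg eb b00 gE bE.
Qed.

(** The operator applied to the tube barrier, without its positive exponential factor; S stands for
    rho^2 - y^2. The second derivative contributes -2 D, one D is kept as margin, and [K] absorbs
    the terms linear in S by completing the square. *)
Lemma tube_inequality (S y rho D K : R) : 0 < rho -> 0 <= S -> `|y| <= rho ->
  D = 2 * sigma ^+ 2 * rho ^+ 2 ->
  K = r + (4 * `|mu| * rho + 6 * sigma ^+ 2) ^+ 2 / (4 * D) ->
  - K * S ^+ 2 + 4 * mu * y * S - sigma ^+ 2 / 2 * (8 * rho ^+ 2 - 12 * S) + r * S ^+ 2
    <= - D.
Proof.
move=> rho0 S0 yrho DD KK.
pose B := 4 * `|mu| * rho + 6 * sigma ^+ 2.
have D0 : 0 < D by rewrite DD !mulr_gt0// exprn_gt0.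
have h1 : mu * y * S <= `|mu| * rho * S.
  rewrite ler_wpM2r// (le_trans (ler_norm _))// normrM ler_wpM2l//.
have h2 : B * S - B ^+ 2 / (4 * D) * S ^+ 2 - D <= 0.
  have -> : B * S - B ^+ 2 / (4 * D) * S ^+ 2 - D = - ((B * S - 2 * D) ^+ 2 / (4 * D)).
    by field; rewrite gt_eqF.
  by rewrite oppr_le0 divr_ge0 ?sqr_ge0// mulr_ge0// ltW.
have DE : sigma ^+ 2 / 2 * (8 * rho ^+ 2 - 12 * S) = 2 * D - 6 * sigma ^+ 2 * S.
  by rewrite DD; field.
have BE : B * S = 4 * (`|mu| * rho * S) + 6 * sigma ^+ 2 * S by rewrite /B; ring.
have [X XE] : exists X, X = B ^+ 2 / (4 * D) by exists (B ^+ 2 / (4 * D)).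
have KE : K = r + X by rewrite XE KK.
rewrite -XE BE in h2; rewrite DE KE; lra.
Qed.

(** Positivity of the time increment is propagated from [t0] by the tube barrier. Monotonicity keeps
    Y > psi2 in the tube at later times, so the increment is a supersolution throughout it. *)
Lemma shift_gt_at_lnK2 (h s t1 : R) : 0 < h -> 0 < s -> s <= t1 -> t1 + h < T ->
  exists2 e, 0 < e & forall u : R, s <= u -> u <= t1 ->
    e <= Y (ln K2, u + h) + - Y (ln K2, u).
Proof.
move=> h0 s0 st1 t1T; have lK := lnk2K2.
have hT : h <= T by lra.
have shT : s + h <= T by lra.
have [t0 [rho [a [/andP[t00 t0s] /andP[rho0 rhol] a0 Ha]]]] := near_lnK2 h0 hT s0 shT.
pose D := 2 * sigma ^+ 2 * rho ^+ 2.
pose K := r + (4 * `|mu| * rho + 6 * sigma ^+ 2) ^+ 2 / (4 * D).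
have D0 : 0 < D by rewrite !mulr_gt0// exprn_gt0.
have K0 : 0 < K by rewrite ltr_wpDr// divr_ge0 ?sqr_ge0// mulr_ge0// ltW.
have rho4 : 0 < (rho ^+ 2) ^+ 2 by rewrite !exprn_gt0.
(* The barrier is then at most [a] on the bottom of the tube. *)
pose e := a / (rho ^+ 2) ^+ 2.
have e0 : 0 < e by rewrite divr_gt0.
have mE (u u' : R) : u' <= u -> expR (- K * u + 0) <= expR (- K * u' + 0).
  by move=> uu; rewrite ler_expR lerD2r !mulNr lerN2 ler_pM2l.
have E0 u : 0 < e * expR (- K * u + 0) by rewrite mulr_gt0// expR_gt0.
pose c := e * expR (- K * t1 + 0) * D.
have c0 : 0 < c by rewrite mulr_gt0.
have la : ln k2 <= ln K2 - rho by lra.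
have cS := @shift_within _ k2 T Y Yc h (ln K2 - rho) (ln K2 + rho) t0 t1 la (ltW t00) (ltW h0) (ltW t1T).
have H := @super_comparison _ sigma r q r0 _ _ _ _ _ _ _ _ _ _ c0 cS
  (C21_tube e K (ln K2) rho).
exists (e * expR (- K * t1 + 0) * (rho ^+ 2) ^+ 2) => [|u su ut1]; first by rewrite mulr_gt0.
have := H _ _ _ (ln K2, u); rewrite /= subrr expr0n subr0 => {}H.
apply: (@le_trans _ _ (e * expR (- K * u + 0) * (rho ^+ 2) ^+ 2)).
  by rewrite ler_pM2r// ler_pM2l// mE.
have Srho (y : R) : ln K2 - rho <= y -> y <= ln K2 + rho ->
    0 <= rho ^+ 2 - (y - ln K2) ^+ 2 <= rho ^+ 2 /\ `|y - ln K2| <= rho.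
  move=> y1 y2; have yr : `|y - ln K2| <= rho by rewrite ler_distl y1.
  split=> //; rewrite gerBl sqr_ge0 andbT subr_ge0 -(real_normK (num_real (y - ln K2))).
  by rewrite ler_sqr ?nnegrE// ltW.
apply: H.
- move=> [y v] [/andP[/= y1 y2] /andP[/= v1 v2]]; rewrite /opL/= -/mu.
  have [/andP[S0 _] yr] := Srho _ y1 y2.
  set S := rho ^+ 2 - _ in S0 *.
  have ineq := tube_inequality rho0 S0 yr (erefl D) (erefl K).
  have c1 : c <= e * expR (- K * v + 0) * D by rewrite ler_pM2r// ler_pM2l// mE.
  have := ineq; rewrite -(ler_pM2l (E0 v)) => {}ineq.
  by move: (expR _) ineq c1 => E ineq c1; lra_from ineq c1.
- move=> [y v] [/andP[/= y1 y2] /andP[/= v1 v2]].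
  have v0 : 0 <= Y (y, v + h) + - Y (y, v) by apply: monotone_shift_ge0; lra_from y1 v1 v2 la t00 h0 t1T.
  case=> [E|E|E].
  + have -> : rho ^+ 2 - (y - ln K2) ^+ 2 = 0 by rewrite E; ring.
    by rewrite expr0n/= mulr0.
  + have -> : rho ^+ 2 - (y - ln K2) ^+ 2 = 0 by rewrite E; ring.
    by rewrite expr0n/= mulr0.
  + have [/andP[S0 S1] yr] := Srho _ y1 y2.
    have [aY _] := Ha _ yr; rewrite E; apply: le_trans aY.
    have -> : a = e * (rho ^+ 2) ^+ 2 by rewrite /e divfK// gt_eqF.
    rewrite -mulrA ler_pM2l// -[leRHS]mul1r ler_pM ?expR_ge0 ?sqr_ge0//.
      by rewrite -expR0 ler_expR addr0 mulNr oppr_le0 mulr_ge0// ltW.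
    by rewrite ler_sqr ?nnegrE// (le_trans S0).
- move=> [y v] /andP[/= y1 y2] /andP[/= v1 v2] _.
  have [_ yr] := Srho _ (ltW y1) (ltW y2).
  have [_ psiY] := Ha _ yr.
  apply: super_shift; [lra_from y1 la|lra_from v1 t00|exact: ltW|lra_from v2 t1T|].
  by apply: lt_le_trans psiY _; apply: Ynd; lra_from y1 v1 v2 la t00 h0 t1T.
- by split; apply/andP; split; lra_from rho0 t0s su ut1.
Qed.

(* The barrier e3 (exp (al (x - b - k (t1 - t))) - 1), with k chosen so that its
   zero set joins (b, t1) to (ln K2, s), is negative on the other two sides. *)
Lemma shift_hopf (h b s t1 e : R) : 0 <= h -> ln k2 < b -> b < ln K2 -> 0 < s -> s < t1 ->
  t1 + h < T -> 0 < e ->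
  (forall u : R, s <= u -> u <= t1 -> e <= Y (ln K2, u + h) + - Y (ln K2, u)) ->
  (forall x u, b < x -> x <= ln K2 -> s <= u -> u <= t1 -> G x < Y (x, u)) ->
  exists2 c, 0 < c & forall x, b <= x -> x <= ln K2 ->
    c * (x - b) <= Y (x, t1 + h) + - Y (x, t1).
Proof.
move=> h0 lb bl s0 st1 t1T e0 He Hb; have lK := lnk2K2.
have s20 : 0 < sigma ^+ 2 by rewrite exprn_gt0.
pose k := (ln K2 - b) / (t1 - s).
have k0 : 0 < k by rewrite divr_gt0// subr_gt0.
have kE : k * (t1 - s) = ln K2 - b by rewrite /k divfK// subr_eq0 gt_eqF.
(* Steep enough for sigma^2 al^2 / 2 to dominate the motion k al, the drift and r. *)
pose al := 1 + 2 * (k + `|mu| + r) / sigma ^+ 2.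
have al1 : 1 <= al.
  have nn : 0 <= k + `|mu| + r by rewrite addr_ge0 ?(ltW r0)// addr_ge0 ?(ltW k0).
  by rewrite lerDl divr_ge0 ?(ltW s20)// mulr_ge0.
have al0 : 0 < al by rewrite (lt_le_trans ltr01).
have alE : sigma ^+ 2 / 2 * al = sigma ^+ 2 / 2 + (k + `|mu| + r).
  by rewrite /al; field; rewrite gt_eqF.
have al_ineq : al * k - sigma ^+ 2 / 2 * al * al - mu * al + r <= 0.
  rewrite alE.
  have h1 : - mu * al <= `|mu| * al.
    by rewrite ler_pM2r// (le_trans (ler_norm _))// normrN.
  have h2 : r <= r * al by rewrite ler_peMr// ltW.
  have h3 : 0 <= sigma ^+ 2 / 2 * al by rewrite mulr_ge0 ?divr_ge0// ltW.
  lra.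
(* Keeps the barrier below [e] on x = ln K2; its constant part -e3 yields the margin e3 r. *)
pose e3 := e / expR (al * (ln K2 - b)).
have e30 : 0 < e3 by rewrite divr_gt0// expR_gt0.
have c0 : 0 < e3 * r by rewrite mulr_gt0.
have cS := @shift_within _ k2 T Y Yc h b (ln K2) s t1 (ltW lb) (ltW s0) h0 (ltW t1T).
have H := @super_comparison _ sigma r q r0 _ _ _ _ _ _ _ _ _ _ c0 cS
  (C21_travelling_exp e3 al (al * k) (- al * b - al * k * t1)).
exists (e3 * al); first by rewrite mulr_gt0.
move=> x bx xl; have := H _ _ _ (x, t1); rewrite /= => {}H.
apply: (@le_trans _ _ (e3 * (expR (al * x + al * k * t1 + (- al * b - al * k * t1)) - 1))).
  rewrite -(mulrA e3 al) (ler_pM2l e30).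
  have -> : al * x + al * k * t1 + (- al * b - al * k * t1) = al * (x - b) by ring.
  by have := expR_ge1Dx (al * (x - b)) => h1; lra_from h1.
have expo y u : al * y + al * k * u + (- al * b - al * k * t1) =
    al * ((y - b) - k * (t1 - u)) by ring.
apply: H.
- move=> [y v] [/andP[/= y1 y2] /andP[/= v1 v2]]; rewrite /opL/= -/mu.
  have := expR_ge0 (al * y + al * k * v + (- al * b - al * k * t1)).
  move: (expR _) => E E0.
  have : e3 * (E * (al * k - sigma ^+ 2 / 2 * al * al - mu * al + r)) <= 0.
    by rewrite pmulr_rle0// mulr_ge0_le0.
  move=> h1; lra_from h1.
- move=> [y v] [/andP[/= y1 y2] /andP[/= v1 v2]].
  have v0 : 0 <= Y (y, v + h) + - Y (y, v) by apply: monotone_shift_ge0; lra_from y1 v1 v2 lb s0 h0 t1T.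
  have neg : (y - b) - k * (t1 - v) <= 0 ->
      e3 * (expR (al * y + al * k * v + (- al * b - al * k * t1)) - 1) <=
      Y (y, v + h) + - Y (y, v).
    move=> ex0; apply: le_trans v0; rewrite pmulr_rle0// subr_le0 -expR0 ler_expR expo.
    by rewrite pmulr_rle0.
  have kv : 0 <= k * (t1 - v) by rewrite mulr_ge0 ?(ltW k0)// subr_ge0.
  case=> [E|E|E].
  + by apply: neg; rewrite E subrr sub0r oppr_le0.
  + rewrite E; apply: le_trans (He _ v1 v2).
    have eE : e = e3 * expR (al * (ln K2 - b)) by rewrite /e3 divfK// gt_eqF// expR_gt0.
    rewrite expo [leRHS]eE ler_pM2l// lerBlDr (@le_trans _ _ (expR (al * (ln K2 - b))))//.
      by rewrite ler_expR ler_pM2l// lerBlDr lerDl.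
    by rewrite lerDl.
  + by apply: neg; rewrite E kE lerBlDr add0r lerD2r.
- move=> [y v] /andP[/= y1 y2] /andP[/= v1 v2] _.
  apply: super_shift; [exact: lt_trans y1|exact: lt_trans v1|exact: h0|lra_from v2 t1T|].
  rewrite /psi psi2_in ?(ltW y2)//; apply: Hb => //; exact: ltW.
- by split; apply/andP; split; lra_from bx xl s0 st1.
Qed.

Lemma contact_moves (b s t : R) : ln k2 < b -> b < ln K2 -> 0 < s -> s < t -> t <= T ->
  Y (b, t) = G b ->
  (forall x u, b < x -> x <= ln K2 -> s <= u -> u <= t -> G x < Y (x, u)) -> False.
Proof.
move=> lb bl s0 st tT YGb Hb; have lK := lnk2K2.
(* The Hopf bound is taken at t1 = s + 2 h and the kink at t2 = s + 7 h / 2 < t. For times in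
   [t2 - h / 2, t2] = [t1 + h, t2], Y(x, u) >= Y(x, t1 + h) inherits the linear growth. *)
pose h := (t - s) / 4.
have h0 : 0 < h by rewrite divr_gt0// subr_gt0.
have ht : t = s + 4 * h by rewrite /h; field.
pose t1 := s + 2 * h; pose t2 := t1 + h + h / 2.
have t1E : t1 = s + 2 * h by [].
have t2E : t2 = t1 + h + h / 2 by [].
have st1 : s < t1 by lra.
have t1T : t1 + h < T by lra.
have t2t : t2 < t by lra.
clearbody h t1 t2.
have [e e0 He] := shift_gt_at_lnK2 h0 s0 (ltW st1) t1T.
have Hb1 x u : b < x -> x <= ln K2 -> s <= u -> u <= t1 -> G x < Y (x, u).
  by move=> bx xl su ut; apply: Hb => //; lra.
have [c c0 Hc] := shift_hopf (ltW h0) lb bl s0 st1 t1T e0 He Hb1.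
have zQ : openQ k2 T (b, t2) by split=> //=; apply/andP; split; lra_from h0 s0 st1 t2E t2t tT.
have Qb : Q (b, t2) by apply: QE; lra_from lb h0 s0 st1 t2E t2t tT.
have Yb2 : Y (b, t2) = G b.
  apply/eqP; rewrite eq_le; apply/andP; split; last exact: (YG Qb).
  by rewrite -YGb; apply: Ynd; lra_from lb h0 s0 st1 t2E t2t tT.
pose d := Num.min (h / 2) (ln K2 - b).
have d0 : 0 < d by rewrite lt_min divr_gt0//= subr_gt0.
have [dh db] : d <= h / 2 /\ d <= ln K2 - b by split; rewrite /d ge_min lexx ?orbT.
apply: (no_kink zQ c0 d0 Yb2) => -[x u] Qxu [/= w1 w2] ut.
move: w1 w2; rewrite !ler_distl => /andP[w1 w1'] /andP[w2 w2'].
have [bx|xb] := leP b x; last first.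
  by apply: le_trans (YG Qxu); rewrite gerDl pmulr_rle0// subr_le0 ltW.
have xl : x <= ln K2 by lra_from w1' db.
have := Hc _ bx xl.
have Q1 : Q (x, t1) by apply: QE; lra_from lb bx s0 st1 h0 t1T.
have := YG Q1; rewrite /=.
have uT : u <= T by case: Qxu => _ /andP[].
have : Y (x, t1 + h) <= Y (x, u) by apply: Ynd; lra_from lb bx s0 st1 h0 w2 dh t2E uT.
by rewrite -/G => h1 h2 h3; lra_from h1 h2 h3.
Qed.

End free_boundary.

(** * The inner free boundary *)

Theorem theorem4p8 (R : realType) (K1 k1 k2 K2 sigma r q T : R)
  (hK1 : 0 < K1) (hK1k1 : K1 < k1) (hk1k2 : k1 < k2) (hk2K2 : k2 < K2)
  (hsigma : 0 < sigma) (hr : 0 < r) (hq : 0 <= q) (hT : 0 < T)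
  (p : R) (hp : 1 < p) (Y : R * R -> R)
  (hY : bounded_strong_solution K1 k2 K2 sigma r q T p Y) :
  let B := inner_boundary K1 k2 K2 Y in
  [/\ forall s t, 0 < s -> s <= t -> t <= T -> B t <= B s,
      {within `]0, T], continuous B},
      B tau @[tau --> 0^'+] -->
        (if q == 0 then ln K2
         else Num.max (ln k2)
                (Num.min (ln K2) (ln (r * (K2 + k2 - K1) / q)))),
      forall s t, 0 < s -> s < t -> t <= T ->
        ln k2 < B s -> ln k2 < B t -> B t < B s &
      0 < q -> r * (K2 + k2 - K1) / q <= k2 ->
        forall tau, 0 < tau <= T -> B tau = ln k2].
Proof.
case: hY => hS hM B.
have [Yx [Yxx [Yt [[cY _ _] [Ydom _ _ Yinit Ybd]]]]] := hS.
have k20 : 0 < k2 by lra.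
have K20 : 0 < K2 by lra.
have lK : ln k2 < ln K2 by rewrite ltr_ln ?posrE.
pose G := payoff K1 k2 K2; pose C := K2 + k2 - K1.
have C0 : 0 < C by rewrite /C; lra.
have psik2 : psi2 K1 k2 K2 (ln k2) = K2 - K1.
  by rewrite psi2_in ?(ltW lK)// /payoff lnK ?posrE//; ring.
have Y0 x : ln k2 <= x -> Y (x, 0) = psi2 K1 k2 K2 x.
  rewrite le_eqVlt => /predU1P[<-|]; last exact: Yinit.
  by rewrite psik2 Ybd// lexx ltW.
have Yge z : clQ k2 T z -> psi2 K1 k2 K2 z.1 <= Y z.
  case: z => x t [/= lx /andP[t0 tT]].
  move: lx; rewrite le_eqVlt => /predU1P[<-|lx]; first by rewrite psik2 Ybd// t0.
  move: t0; rewrite le_eqVlt => /predU1P[<-|t0]; first by rewrite Y0// ltW.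
  by apply: (Ydom (x, t)); split=> //=; rewrite t0.
have Ysup z (zQ : openQ k2 T z) := (strong_solution_super hp hS zQ).1.
have Ysub z (zQ : openQ k2 T z) := (strong_solution_super hp hS zQ).2.
have Ynd := Y_nondecreasing hr cY hM Yge Y0 Ybd Ysup Ysub.
have QE x t : ln k2 <= x -> 0 <= t -> t <= T -> clQ k2 T (x, t).
  by move=> *; split=> //=; apply/andP.
have YG x t : ln k2 <= x -> 0 <= t -> t <= T -> G x <= Y (x, t).
  by move=> *; apply: le_trans (psi2_ge _ _ _ _) (Yge (x, t) _); exact: QE.
have BP t : 0 <= t -> t <= T -> [/\ ln k2 <= B t, B t <= ln K2, Y (B t, t) = G (B t) &
    forall x, ln k2 <= x -> x <= ln K2 -> Y (x, t) = G x -> x <= B t].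
  move=> t0 tT; have t0T : 0 <= t <= T by rewrite t0.
  have [[/andP[b1 b2] b3] ub] := inner_boundary_max k20 hk2K2 hS t0T.
  split=> //; first by rewrite -/B in b3 *; rewrite b3 /G /payoff; ring.
  move=> x x1 x2 x3; apply: ub; split; first by rewrite x1.
  by rewrite x3 /G /payoff; ring.
have Bnd s t : 0 <= s -> s <= t -> t <= T -> B t <= B s.
  move=> s0 st tT; have [b1 b2 b3 _] := BP t (le_trans s0 st) tT.
  have [_ _ _ ub] := BP s s0 (le_trans st tT); apply: ub => //.
  apply/eqP; rewrite eq_le YG ?andbT//; last exact: le_trans tT.
  by rewrite -b3; exact: Ynd.
have cle x t := @contact_le _ K1 k2 K2 sigma r q T hr Y Yge Ysup Ynd x t.
have Blt t : 0 < t -> t <= T -> B t < ln K2.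
  move=> t0 tT; have [_ b2 b3 _] := BP t (ltW t0) tT.
  rewrite lt_neqAle b2 andbT; apply/eqP => E.
  have := contact_lt_lnK2 k20 hk2K2 hsigma hr hq Yge Ysup Ynd t0 tT.
  by rewrite -E b3 ltxx.
(* Contact at ln k2 is imposed by the boundary condition and says nothing about q, whence ln k2 < B
   t. *)
have BqC t : 0 < t -> t <= T -> ln k2 < B t -> q * expR (B t) <= r * C.
  by move=> t0 tT lB; have [_ _ b3 _] := BP t (ltW t0) tT; exact: cle b3.
have Bconn t x : 0 < t -> t < T -> ln k2 <= x -> x <= B t -> Y (x, t) = G x.
  move=> t0 tT lx xB; have [b1 b2 b3 _] := BP t (ltW t0) (ltW tT).
  move: b1; rewrite le_eqVlt => /predU1P[E|lB].
    by have -> : x = B t by apply/eqP; rewrite eq_le xB -E.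
  have qC := BqC t t0 (ltW tT) lB.
  exact: (contact_connected k20 hk2K2 hr hq cY Yge Y0 Ybd Ysub Ynd lB b2 (ltW t0) tT qC b3 lx xB).
(* Used with L = B t0 for right continuity and with t0 = 0 for the initial value. The interval of
   radius e / 4 about L - e / 2 lies strictly left of L, which makes the inequality on q strict
   there. *)
have low L e t0 : 0 < e -> ln k2 <= L - e -> L <= ln K2 -> q * expR L <= r * C ->
    0 <= t0 -> t0 < T ->
    (forall y, ln k2 <= y -> y < L -> Y (y, t0) = G y) ->
    exists2 d, 0 < d & forall u, t0 <= u -> u < t0 + d -> u < T -> L - e < B u.
  move=> e0 lL LK qL t00 t0T ct.
  have d0 : 0 < e / 4 by rewrite divr_gt0.
  have h1 : ln k2 <= (L - e / 2) - e / 4 by clear - lL e0; lra.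
  have h2 : (L - e / 2) + e / 4 <= ln K2 by clear - LK e0; lra.
  have h3 : q * expR ((L - e / 2) + e / 4) < r * C.
    have ll : L - e / 2 + e / 4 < L by clear - e0; lra.
    move: hq; rewrite le_eqVlt => /predU1P[<-|q1].
      by rewrite mul0r mulr_gt0.
    by apply: lt_le_trans qL; rewrite ltr_pM2l// ltr_expR.
  have h4 y : `|y - (L - e / 2)| <= e / 4 -> Y (y, t0) = payoff K1 k2 K2 y.
    by rewrite ler_distl => /andP[y1 y2]; apply: ct; clear - lL e0 y1 y2; lra.
  have [d d1 Hd] := contact_persists k20 hk2K2 hsigma hr hq cY Yge Ysub d0 h1 h2 t00 t0T h3 h4.
  exists d => // u tu ut uT.
  have [_ _ _ ub] := BP u (le_trans t00 tu) (ltW uT).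
  have : L - e / 2 <= B u.
    by apply: ub; [clear - lL e0; lra|clear - LK e0; lra|apply: Hd => //; exact: ltW].
  by clear - e0; lra.
split.
- by move=> s t s0; apply: Bnd; exact: ltW.
- apply/subspace_continuousP => t; rewrite /= in_itv/= => /andP[t0 tT].
  have [b1 b2 b3 ub] := BP t (ltW t0) tT.
  apply/cvgrPdist_lt => e e0.
  (* If B u >= B t + e just before [t], connectedness gives contact at B t + e, against the positive
     gap there at time [t]. *)
  have [dl dl0 Hl] : exists2 d, 0 < d &
      forall u, 0 < u -> t - d < u -> u <= t -> B u < B t + e.
    have [Be|Be] := ltP (ln K2) (B t + e).
      exists 1 => // u u0 _ ut; have [_ b _ _] := BP u (ltW u0) (le_trans ut tT).
      exact: le_lt_trans Be.
    have lB : ln k2 <= B t + e by rewrite ler_wpDr// ltW.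
    have Qx : clQ k2 T (B t + e, t) by exact: QE lB (ltW t0) tT.
    have gap0 : 0 < Y (B t + e, t) - G (B t + e).
      rewrite subr_gt0 lt_neqAle YG ?(ltW t0)//.
      rewrite andbT; apply/eqP => /esym E.
      by have := ub _ lB Be E; rewrite gerDl leNgt e0.
    have gap20 : 0 < (Y (B t + e, t) - G (B t + e)) / 2 by rewrite divr_gt0.
    have /within_continuous_cboxP/(_ _ Qx _ gap20)[d d0 Hd] := cY.
    exists d => // u u0 du ut; rewrite ltNge; apply/negP => BuB.
    move: ut; rewrite le_eqVlt => /predU1P[E|ut]; first by rewrite E gerDl leNgt e0 in BuB.
    have E : Y (B t + e, u) = G (B t + e) by apply: Bconn => //; exact: lt_le_trans tT.
    have Qu : clQ k2 T (B t + e, u) by exact: QE lB (ltW u0) (le_trans (ltW ut) tT).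
    have cu : cbox (B t + e, t) d (B t + e, u).
      split; rewrite /= ?subrr ?normr0 ?(ltW d0)// ler_distl; apply/andP.
      by split; [exact: ltW|clear - ut d0; lra].
    have := Hd _ Qu cu; rewrite E ler_norml => /andP[h _].
    by clear - h gap0; lra.
  have [dr dr0 Hr] : exists2 d, 0 < d &
      forall u, t <= u -> u < t + d -> u <= T -> B t - e < B u.
    have [Be|Be] := ltP (B t - e) (ln k2).
      exists 1 => // u tu _ uT; have [b _ _ _] := BP u (le_trans (ltW t0) tu) uT.
      exact: lt_le_trans b.
    have [tT'|tT'] := ltP t T; last first.
      exists 1 => // u tu _ uT; have -> : u = t; last by rewrite gtrBl.
      by apply/eqP; rewrite eq_le tu (le_trans uT).
    have qC : q * expR (B t) <= r * C by apply: BqC => //; clear - Be e0; lra.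
    have [d d0 Hd] := low (B t) e t e0 Be b2 qC (ltW t0) tT'
      (fun y y1 y2 => Bconn t y t0 tT' y1 (ltW y2)).
    exists (Num.min d (T - t)) => [|u tu ud uT]; first by rewrite lt_min d0 subr_gt0.
    have : u - t < Num.min d (T - t) by rewrite ltrBlDl.
    by rewrite lt_min => /andP[u1 u2]; apply: Hd => //; [rewrite -ltrBlDl|rewrite -(ltrD2r (- t))].
  have d0 : 0 < Num.min dl dr by rewrite lt_min dl0.
  apply/nbhs_ballP; exists (Num.min dl dr) => //= u; rewrite /ball/= lt_min => /andP[u1 u2].
  rewrite in_itv/= => /andP[u0 uT]; rewrite ltr_distl in u1; rewrite ltr_distl in u2.
  case/andP: u1 => _ u1; case/andP: u2 => u2 _.
  change (`|B t - B u| < e).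
  rewrite ltr_distl; have [ut|/ltW tu] := leP u t.
    have := Bnd u t (ltW u0) ut tT; have := Hl u u0 ltac:(clear - u1; lra) ut => h1 h2.
    by apply/andP; split; clear - e0 h1 h2; lra.
  have := Bnd t u (ltW t0) tu uT; have := Hr u tu ltac:(clear - u2; lra) uT => h1 h2.
  by apply/andP; split; clear - e0 h1 h2; lra.
- set L := (X in _ --> X).
  have BL t : 0 < t -> t <= T -> B t <= L.
    move=> t0 tT; have [b1 b2 b3 _] := BP t (ltW t0) tT.
    rewrite /L; have [//|q1] := eqVneq q 0; rewrite le_max.
    move: b1; rewrite le_eqVlt => /predU1P[->|lB]; first by rewrite lexx.
    apply/orP; right; rewrite le_min b2/=.
    have qp : 0 < q by rewrite lt_neqAle eq_sym q1.
    rewrite -[B t]expRK ler_ln ?posrE ?expR_gt0 ?divr_gt0 ?mulr_gt0//.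
    by rewrite ler_pdivlMr// mulrC; exact: BqC.
  have LK : L <= ln K2.
    rewrite /L; case: ifP => // _; rewrite ge_max (ltW lK)/=.
    by rewrite ge_min lexx.
  (* For L = ln k2 the inequality can fail, but then the lower bound on B is immediate. *)
  have qL : ln k2 < L -> q * expR L <= r * C.
    rewrite /L; have [->|q1] := eqVneq q 0; first by rewrite mul0r ltW// mulr_gt0.
    have qp : 0 < q by rewrite lt_neqAle eq_sym q1.
    rewrite lt_max ltxx/= => lm; rewrite max_r ?(ltW lm)//.
    rewrite mulrC -ler_pdivlMr// -[leRHS]lnK ?posrE ?divr_gt0 ?mulr_gt0//.
    by rewrite ler_expR ge_min lexx orbT.
  apply/cvgrPdist_lt => e e0.
  have [d d0 Hd] : exists2 d, 0 < d & forall u, 0 < u -> u < d -> u <= T -> L - e < B u.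
    have [Le|Le] := ltP (L - e) (ln k2).
      exists 1 => // u u0 _ uT; have [b _ _ _] := BP u (ltW u0) uT.
      exact: lt_le_trans b.
    have qL' : q * expR L <= r * C by apply: qL; clear - Le e0; lra.
    have ct0 y : ln k2 <= y -> y < L -> Y (y, 0) = G y.
      by move=> ly yL; rewrite Y0// psi2_in// ltW// (lt_le_trans yL).
    have [d d0 Hd] := low L e 0 e0 Le LK qL' (lexx _) hT ct0.
    exists (Num.min d T) => [|u u0]; first by rewrite lt_min d0.
    by rewrite lt_min => /andP[ud uT] _; apply: Hd => //; [exact: ltW|rewrite add0r].
  near=> u.
  have u0 : 0 < u by near: u; exact: nbhs_right_gt.
  have ud : u < d by near: u; exact: nbhs_right_lt.
  have uT : u <= T by near: u; exact: nbhs_right_ltW.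
  have := BL u u0 uT; have := Hd u u0 ud uT => h1 h2.
  by rewrite ltr_distl; apply/andP; split; clear - e0 h1 h2; lra.
- move=> s t s0 st tT lBs lBt.
  rewrite ltNge; apply/negP => BsBt.
  have t0 : 0 < t := lt_trans s0 st.
  have [_ _ b3 _] := BP t (ltW t0) tT.
  (* On [s, t] one has B <= B s <= B t, so no contact occurs to the right of B t. *)
  apply: (contact_moves k20 hk2K2 hsigma hr hq cY Yge Y0 Ysup Ysub Ynd
    lBt (Blt t t0 tT) s0 st tT b3).
  move=> x u Bx xK su ut.
  have u0 : 0 < u := lt_le_trans s0 su.
  have uT : u <= T := le_trans ut tT.
  have lx : ln k2 <= x by apply: ltW; apply: lt_trans Bx.
  rewrite lt_neqAle YG ?(ltW u0) ?andbT//.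
  apply/eqP => /esym E; have [_ _ _ ub] := BP u (ltW u0) uT.
  have := ub x lx xK E; have := Bnd s u (ltW s0) su uT => h1 h2.
  by have := lt_le_trans Bx (le_trans h2 (le_trans h1 BsBt)); rewrite ltxx.
- move=> qp rCq t /andP[t0 tT]; have [b1 _ _ _] := BP t (ltW t0) tT.
  apply/eqP; rewrite eq_le b1 andbT leNgt; apply/negP => lB.
  have := BqC t t0 tT lB.
  rewrite mulrC -ler_pdivlMr// => h; have := le_trans h rCq.
  by rewrite -(lnK (x := k2)) ?posrE// ler_expR leNgt lB.
Unshelve. all: by end_near. Qed.
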